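(* Let $k$ be a perfect field of characteristic $p>0$ and let $(\widetilde Y,\widetilde F_Y)$ be a Frobenius lifting of a $k$-scheme $Y$. Let $\phi\colon Z\to Y$ be a morphism of $k$-schemes and let $\widetilde Z$ be a lifting of $Z$ over $W_2(k)$. Then there exists a morphism $\psi\colon\widetilde Z\to\widetilde Y$, canonically defined as the composition $$\widetilde Z\xrightarrow{\ \theta_{\widetilde Z}\ }W_2(Z)\xrightarrow{\ W_2(\phi)\ }W_2(Y)\xrightarrow{\ \nu_{\widetilde Y,\widetilde F_Y}\ }\widetilde Y,$$ such that $\psi|_Z=F_Y\circ\phi$. If $\widetilde F_Z$ is a lifting of $F_Z$ to $\widetilde Z$, then $\psi\circ\widetilde F_Z=\widetilde F_Y\circ\psi$. Further, if $\widetilde\phi\colon\widetilde Z\to\widetilde Y$ is any lifting of $\phi$, then $\psi=\widetilde F_Y\circ\widetilde\phi$.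
   Context: A lifting of a $k$-scheme is a flat $W_2(k)$-scheme reducing to it. A Frobenius lifting $(\widetilde Y,\widetilde F_Y)$ of $Y$ is a lifting $\widetilde Y$ with a morphism $\widetilde F_Y\colon\widetilde Y\to\widetilde Y$ lifting the absolute Frobenius $F_Y$. $W_2(X)$ denotes the scheme with underlying space that of $X$ and structure sheaf the length-two Witt vectors $W_2(\mathcal O_X)$; it is functorial in $X$. For a $W_2(k)$-scheme $\widetilde X$ with reduction $X=\widetilde X\otimes_{W_2(k)}k$, the morphism $\theta_{\widetilde X}\colon\widetilde X\to W_2(X)$ is defined on functions by $\theta_{\widetilde X}^*(f_0,f_1)=(\tilde f_0)^p+p\tilde f_1$, where $\tilde f_0,\tilde f_1\in\mathcal O_{\widetilde X}$ are any liftings of $f_0,f_1\in\mathcal O_X$. If $\widetilde X$ is flat over $W_2(k)$ and $\widetilde F_X$ lifts $F_X$, the morphism $\nu_{\widetilde X,\widetilde F_X}\colon W_2(X)\to\widetilde X$ is defined on functions by $\nu^*(\tilde f)=(f,\delta(\tilde f))$, where $f$ is the image of $\tilde f$ in $\mathcal O_X$ and $\delta(\tilde f)\in\mathcal O_X$ is the unique element with $\widetilde F_X^*(\tilde f)=\tilde f^p+p\cdot\delta(\tilde f)$. *)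

(* Defs.v *)
From HB Require Import structures.
From mathcomp Require Import all_boot all_order all_algebra generic_quotient.
From mathcomp Require Import boolp classical_sets topology.
From mathcomp Require Import ring.

Set Implicit Arguments.
Unset Strict Implicit.
Unset Printing Implicit Defensive.

Import GRing.Theory.
Local Open Scope classical_set_scope.
Local Open Scope quotient_scope.
Local Open Scope ring_scope.

(* The integral form of ((a + b)^p - a^p - b^p) / p. *)
Definition wittS (p : nat) (R : comPzRingType) (a b : R) : R :=
  \sum_(1 <= i < p) (a ^+ i * b ^+ (p - i)) *+ ('C(p, i) %/ p).

(* To let the [ring] tactic multiply by a variable natural number. *)
Lemma mulrn_ex (n : nat) (R : comPzRingType) :
  exists P : R, forall a, a *+ n = P * a.
Proof. by exists n%:R => a; rewrite mulr_natl. Qed.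

Section WittS.
Variables (p : nat) (pp : prime p).

Lemma wittSE (R : comPzRingType) (a b : R) :
  (a + b) ^+ p = a ^+ p + b ^+ p + wittS p a b *+ p.
Proof.
rewrite addrC exprDn.
rewrite -(big_mkord xpredT (fun i => (b ^+ (p - i) * a ^+ i) *+ 'C(p, i))).
rewrite big_nat_recr //= big_ltn ?prime_gt0 //.
rewrite subnn subn0 !expr0 bin0 binn mulr1 mul1r !mulr1n.
rewrite /wittS -sumrMnl [RHS]addrC [X in _ = _ + X]addrC addrA addrC [RHS]addrC.
congr (_ + _); rewrite [LHS]addrC; congr (_ + _).
rewrite big_nat_cond [RHS]big_nat_cond.
apply: eq_bigr => i /andP[/andP[i0 ip] _].
by rewrite -mulrnA divnK ?prime_dvd_bin ?i0 // mulrC.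
Qed.

Lemma wittSC (R : comPzRingType) (a b : R) : wittS p a b = wittS p b a.
Proof.
rewrite /wittS big_nat_rev /= big_nat_cond [RHS]big_nat_cond.
apply: eq_bigr => i /andP[/andP[i0 ip] _].
rewrite add1n subSS subKn ?(ltnW ip) // bin_sub ?(ltnW ip) //.
by rewrite [a ^+ _ * _]mulrC.
Qed.

Lemma wittS0 (R : comPzRingType) (b : R) : wittS p 0 b = 0.
Proof.
rewrite /wittS big_nat_cond big1 // => i /andP[/andP[i0 _] _].
by rewrite expr0n gtn_eqF // mul0r mul0rn.
Qed.

Lemma wittSM (R : comPzRingType) (c a b : R) :
  wittS p (c * a) (c * b) = c ^+ p * wittS p a b.
Proof.
rewrite /wittS mulr_sumr big_nat_cond [RHS]big_nat_cond.
apply: eq_bigr => i /andP[/andP[_ ip] _].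
have -> : c ^+ p = c ^+ i * c ^+ (p - i) by rewrite -exprD subnKC // ltnW.
by rewrite mulrnAr !exprMn; congr (_ *+ _); ring.
Qed.

Lemma rmorph_wittS (R S : comPzRingType) (f : {rmorphism R -> S}) (a b : R) :
  f (wittS p a b) = wittS p (f a) (f b).
Proof.
rewrite /wittS rmorph_sum; apply: eq_bigr => i _.
by rewrite rmorphMn rmorphM !rmorphXn.
Qed.

Lemma wittSA_mulrn (R : comPzRingType) (a b c : R) :
  (wittS p a b + wittS p (a + b) c) *+ p =
  (wittS p b c + wittS p a (b + c)) *+ p.
Proof.
have E (x y : R) : wittS p x y *+ p = (x + y) ^+ p - x ^+ p - y ^+ p.
  by rewrite wittSE; ring.
by rewrite !mulrnDl !E [a + (b + c)]addrA; ring.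
Qed.

Lemma wittSA_poly (a b c : {poly {poly {poly int}}}) :
  wittS p a b + wittS p (a + b) c = wittS p b c + wittS p a (b + c).
Proof.
have p0 : p%:R != 0 :> {poly {poly {poly int}}}.
  have -> : p%:R = (p%:R : int)%:P%:P%:P :> {poly {poly {poly int}}}.
    by rewrite !polyC_natr.
  by rewrite !polyC_eq0 Num.Theory.pnatr_eq0 -lt0n prime_gt0.
by apply: (mulfI p0); rewrite !mulr_natl; exact: wittSA_mulrn.
Qed.

Lemma poly_eval (A S : comNzRingType) (f : {rmorphism A -> S}) (c : S) :
  exists g : {rmorphism {poly A} -> S}, g 'X = c /\ forall x, g x%:P = f x.
Proof.
exists (horner_morph (fun x => mulrC c (f x))).
by split=> [|x]; [exact: horner_morphX|exact: horner_morphC].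
Qed.

Lemma wittSA_nz (S : comNzRingType) (a b c : S) :
  wittS p a b + wittS p (a + b) c = wittS p b c + wittS p a (b + c).
Proof.
have [f1 [fX1 _]] := poly_eval (intr : {rmorphism int -> S}) a.
have [f2 [fX2 fC2]] := poly_eval f1 b.
have [f3 [fX3 fC3]] := poly_eval f2 c.
have := wittSA_poly ('X%:P%:P) ('X%:P) 'X => /(congr1 f3).
by rewrite 2!rmorphD !rmorph_wittS 2!rmorphD !fC3 fC2 fX1 fX2 fX3.
Qed.

Lemma wittSA (R : comPzRingType) (a b c : R) :
  wittS p a b + wittS p (a + b) c = wittS p b c + wittS p a (b + c).
Proof.
have [R0 | R1] := eqVneq (1 : R) 0.
  by rewrite -[LHS]mul1r -[RHS]mul1r R0 !mul0r.
pose S : comNzRingType := HB.pack (GRing.ComPzRing.sort R)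
  (GRing.ComPzRing.class R) (GRing.PzSemiRing_isNonZero.Build R R1).
exact: (@wittSA_nz S a b c).
Qed.

End WittS.

Record witt2 (p : nat) (pp : prime p) (R : comPzRingType) :=
  Witt2 { w0 : R; w1 : R }.
Arguments Witt2 {p} pp {R} w0 w1.

Section Witt2Ring.
Variables (p : nat) (pp : prime p) (R : comPzRingType).
Local Notation W := (witt2 pp R).
HB.instance Definition _ := gen_eqMixin W.
HB.instance Definition _ := gen_choiceMixin W.

Lemma witt2P (x y : W) : w0 x = w0 y -> w1 x = w1 y -> x = y.
Proof. by case: x y => [x0 x1] [y0 y1] /= -> ->. Qed.

Definition witt2_zero : W := Witt2 pp 0 0.
Definition witt2_one : W := Witt2 pp 1 0.
Definition witt2_add (x y : W) : W :=
  Witt2 pp (w0 x + w0 y) (w1 x + w1 y - wittS p (w0 x) (w0 y)).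
Definition witt2_opp (x : W) : W :=
  Witt2 pp (- w0 x) (- w1 x + wittS p (w0 x) (- w0 x)).
Definition witt2_mul (x y : W) : W :=
  Witt2 pp (w0 x * w0 y)
    (w0 x ^+ p * w1 y + w0 y ^+ p * w1 x + (w1 x * w1 y) *+ p).

Lemma witt2_addA : associative witt2_add.
Proof.
move=> x y z; apply: witt2P; rewrite /= ?addrA //.
have := wittSA pp (w0 x) (w0 y) (w0 z) => E.
transitivity (w1 x + w1 y + w1 z -
  (wittS p (w0 y) (w0 z) + wittS p (w0 x) (w0 y + w0 z))); first ring.
by rewrite -E; ring.
Qed.

Lemma witt2_addC : commutative witt2_add.
Proof.
by move=> x y; apply: witt2P; rewrite /= ?[w0 x + _]addrC // wittSC // [w1 x + _]addrC.
Qed.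

Lemma witt2_add0 : left_id witt2_zero witt2_add.
Proof. by move=> x; apply: witt2P; rewrite /= ?wittS0 ?subr0 add0r. Qed.

Lemma witt2_addN : left_inverse witt2_zero witt2_opp witt2_add.
Proof.
move=> x; apply: witt2P; rewrite /= ?addNr //.
by rewrite [wittS p (- _) _]wittSC //; ring.
Qed.

HB.instance Definition _ := GRing.isZmodule.Build W
  witt2_addA witt2_addC witt2_add0 witt2_addN.

Lemma witt2_mulA : associative witt2_mul.
Proof. by move=> x y z; apply: witt2P; rewrite /= ?exprMn; ring. Qed.

Lemma witt2_mulC : commutative witt2_mul.
Proof. by move=> x y; apply: witt2P; rewrite /=; ring. Qed.

Lemma witt2_mul1 : left_id witt2_one witt2_mul.
Proof. by move=> x; apply: witt2P; rewrite /= ?expr1n; ring. Qed.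

Lemma witt2_mulD : left_distributive witt2_mul witt2_add.
Proof.
move=> x y z; apply: witt2P; rewrite /= ?mulrDl //.
rewrite (wittSE pp (w0 x) (w0 y)) [w0 x * w0 z]mulrC [w0 y * w0 z]mulrC wittSM.
by have [P N] := mulrn_ex p R; rewrite !N; ring.
Qed.

HB.instance Definition _ := GRing.Zmodule_isComPzRing.Build W
  witt2_mulA witt2_mulC witt2_mul1 witt2_mulD.

Lemma w0_is_zmod_morphism : zmod_morphism (@w0 p pp R).
Proof. by []. Qed.
Lemma w0_is_monoid_morphism : monoid_morphism (@w0 p pp R).
Proof. by []. Qed.
HB.instance Definition _ :=
  GRing.isZmodMorphism.Build W R (@w0 p pp R) w0_is_zmod_morphism.
HB.instance Definition _ :=
  GRing.isMonoidMorphism.Build W R (@w0 p pp R) w0_is_monoid_morphism.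

End Witt2Ring.

Section Witt2Map.
Variables (p : nat) (pp : prime p) (R S : comPzRingType) (f : {rmorphism R -> S}).

Definition witt2_map (x : witt2 pp R) : witt2 pp S :=
  Witt2 pp (f (w0 x)) (f (w1 x)).

Lemma witt2_mapD x y : witt2_map (x + y) = witt2_map x + witt2_map y.
Proof.
by apply: witt2P; rewrite /= !(rmorphD, rmorphN) ?rmorph_wittS.
Qed.

Lemma witt2_map_is_zmod_morphism : zmod_morphism witt2_map.
Proof. by move=> x y; apply: (addIr (witt2_map y)); rewrite -witt2_mapD !subrK. Qed.

Lemma witt2_map_is_monoid_morphism : monoid_morphism witt2_map.
Proof.
split=> [|x y]; apply: witt2P; rewrite /= ?rmorph1 ?rmorph0 ?rmorphM //.
by rewrite !rmorphD rmorphMn !rmorphM !rmorphXn.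
Qed.

HB.instance Definition _ := GRing.isZmodMorphism.Build _ _ witt2_map
  witt2_map_is_zmod_morphism.
HB.instance Definition _ := GRing.isMonoidMorphism.Build _ _ witt2_map
  witt2_map_is_monoid_morphism.
End Witt2Map.
Arguments witt2_map {p} pp {R S} f x.

Definition invertible (R : comPzRingType) (a : R) : Prop := exists b, a * b = 1.

Lemma invertibleM (R : comPzRingType) (a b : R) :
  invertible (a * b) <-> invertible a /\ invertible b.
Proof.
split=> [[c abc]|[[c ac] [d bd]]].
  by split; [exists (b * c)|exists (a * c)]; rewrite -abc; ring.
by exists (c * d); rewrite mulrACA ac bd mulr1.
Qed.

(* A length-two Witt vector is a unit iff both its ghost components are. *)
Lemma witt2_invertible (p : nat) (pp : prime p) (R : comPzRingType)
    (x : witt2 pp R) :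
  invertible x <-> invertible (w0 x) /\ invertible (w0 x ^+ p + w1 x *+ p).
Proof.
have [P N] := mulrn_ex p R.
split=> [[y xy]|[[c ac] [d gd]]].
  have E0 : w0 x * w0 y = 1 by rewrite -[RHS]/(w0 (1 : witt2 pp R)) -xy.
  have E1 : w0 x ^+ p * w1 y + w0 y ^+ p * w1 x + (w1 x * w1 y) *+ p = 0.
    by rewrite -[RHS]/(w1 (1 : witt2 pp R)) -xy.
  split; first by exists (w0 y).
  exists (w0 y ^+ p + w1 y *+ p).
  transitivity ((w0 x * w0 y) ^+ p +
    (w0 x ^+ p * w1 y + w0 y ^+ p * w1 x + (w1 x * w1 y) *+ p) *+ p).
    by rewrite exprMn !N; ring.
  by rewrite E0 E1 expr1n mul0rn addr0.
exists (Witt2 pp c (- (c ^+ p * w1 x * d))).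
apply: witt2P => //=.
transitivity (c ^+ p * w1 x * (1 - (w0 x ^+ p + w1 x *+ p) * d)).
  by rewrite !N; ring.
by rewrite gd subrr mulr0.
Qed.

Identity Coercion set_pred : set >-> Funclass.

Record opens (X : topologicalType) :=
  Opens { open_set :> set X; open_setP : open open_set }.
Arguments Opens {X} open_set open_setP.

Definition opensT (X : topologicalType) : opens X := Opens setT openT.

Definition opensI (X : topologicalType) (U V : opens X) : opens X :=
  Opens (U `&` V) (openI (open_setP U) (open_setP V)).

Lemma opensIl (X : topologicalType) (U V : opens X) : opensI U V `<=` U.
Proof. exact: subIsetl. Qed.

Lemma opensIr (X : topologicalType) (U V : opens X) : opensI U V `<=` V.
Proof. exact: subIsetr. Qed.

Definition opens_preim (X Y : topologicalType) (f : X -> Y) (fc : continuous f)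
    (V : opens Y) : opens X :=
  Opens (f @^-1` V) (open_comp (fun x _ => fc x) (open_setP V)).

(* Rings of sections may vanish, hence the use of [comPzRingType]. *)
Record ringedSpace := RingedSpace {
  space :> topologicalType;
  sec : opens space -> comPzRingType;
  res : forall U V : opens space, V `<=` U -> {rmorphism sec U -> sec V};
  res_id : forall (U : opens space) (h : U `<=` U) s, res h s = s;
  res_comp : forall (U V W : opens space) (hVU : V `<=` U) (hWV : W `<=` V)
    (hWU : W `<=` U) s, res hWV (res hVU s) = res hWU s;
  res_inj : forall (U : opens space) (I : Type) (V : I -> opens space)
    (hV : forall i, V i `<=` U), U `<=` \bigcup_i V i ->
    forall s t, (forall i, res (hV i) s = res (hV i) t) -> s = t;
  res_glue : forall (U : opens space) (I : Type) (V : I -> opens space)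
    (hV : forall i, V i `<=` U), U `<=` \bigcup_i V i ->
    forall s : (forall i, sec (V i)),
    (forall i j (W : opens space) (hi : W `<=` V i) (hj : W `<=` V j),
       res hi (s i) = res hj (s j)) ->
    exists t, forall i, res (hV i) t = s i
}.
Arguments sec : clear implicits.
Arguments sec X U : rename.
Arguments res {X} {U V} h : rename.

Section Stalk.
Variables (X : ringedSpace) (x : X).

Record pregerm := Pregerm {
  pg_dom : opens X; pg_mem : pg_dom x; pg_sec : sec X pg_dom }.

HB.instance Definition _ := gen_eqMixin pregerm.
HB.instance Definition _ := gen_choiceMixin pregerm.

Definition germ_rel (a b : pregerm) : Prop :=
  exists (W : opens X) (ha : W `<=` pg_dom a) (hb : W `<=` pg_dom b),
    W x /\ res ha (pg_sec a) = res hb (pg_sec b).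

Lemma germ_rel_refl a : germ_rel a a.
Proof. by exists (pg_dom a), (fun _ h => h), (fun _ h => h); split=> //; exact: pg_mem. Qed.

Lemma germ_rel_sym a b : germ_rel a b -> germ_rel b a.
Proof. by move=> [W [ha [hb [Wx E]]]]; exists W, hb, ha. Qed.

Lemma germ_rel_trans a b c : germ_rel a b -> germ_rel b c -> germ_rel a c.
Proof.
move=> [W [ha [hb [Wx E]]]] [W' [hb' [hc [Wx' E']]]].
have h : opensI W W' `<=` W by apply: subIsetl.
have h' : opensI W W' `<=` W' by apply: subIsetr.
exists (opensI W W'), (subset_trans h ha), (subset_trans h' hc); split=> //.
rewrite -(res_comp ha h) E -(res_comp hc h') -E' .
by rewrite (res_comp hb h (subset_trans h hb)) (res_comp hb' h' (subset_trans h hb)).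
Qed.

Definition germ_relb (a b : pregerm) : bool := `[< germ_rel a b >].

Lemma germ_relb_equiv : equiv_class_of germ_relb.
Proof.
split=> [a|a b|b a c].
- exact/asboolP/germ_rel_refl.
- by apply/asboolP/asboolP; exact: germ_rel_sym.
- move=> /asboolP ab /asboolP bc; apply/asboolP; exact: germ_rel_trans ab bc.
Qed.

Canonical germ_equiv := EquivRelPack germ_relb_equiv.

Definition stalk := {eq_quot germ_equiv}.
HB.instance Definition _ := Choice.on stalk.

Definition germ (U : opens X) (Ux : U x) (s : sec X U) : stalk :=
  \pi_stalk (Pregerm Ux s).

Lemma germ_eqP (U V : opens X) (Ux : U x) (Vx : V x) s t :
  germ Ux s = germ Vx t <-> exists (W : opens X) (hU : W `<=` U) (hV : W `<=` V),
    W x /\ res hU s = res hV t.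
Proof.
split=> [/eqmodP/asboolP //|h].
by apply/eqmodP/asboolP.
Qed.

Lemma germ_res (U V : opens X) (Ux : U x) (Vx : V x) (h : V `<=` U) s :
  germ Vx (res h s) = germ Ux s.
Proof.
apply/germ_eqP; exists V, (fun _ h => h), h; split=> //; exact: res_id.
Qed.

Lemma germ_surj (a : stalk) : exists (U : opens X) (Ux : U x) s, a = germ Ux s.
Proof.
exists (pg_dom (repr a)), (pg_mem (repr a)), (pg_sec (repr a)).
rewrite -[LHS]reprK; congr (\pi_ _ _); by case: (repr a).
Qed.

Lemma germ_surj2 (a b : stalk) :
  exists (U : opens X) (Ux : U x) s t, a = germ Ux s /\ b = germ Ux t.
Proof.
have [U [Ux [s ->]]] := germ_surj a; have [V [Vx [t ->]]] := germ_surj b.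
have hU : opensI U V `<=` U by apply: subIsetl.
have hV : opensI U V `<=` V by apply: subIsetr.
have Wx : opensI U V x by [].
by exists (opensI U V), Wx, (res hU s), (res hV t); rewrite !germ_res.
Qed.

Lemma germ_surj3 (a b c : stalk) :
  exists (U : opens X) (Ux : U x) r s t,
    [/\ a = germ Ux r, b = germ Ux s & c = germ Ux t].
Proof.
have [U [Ux [r [s [-> ->]]]]] := germ_surj2 a b; have [V [Vx [t ->]]] := germ_surj c.
have hU : opensI U V `<=` U by apply: subIsetl.
have hV : opensI U V `<=` V by apply: subIsetr.
have Wx : opensI U V x by [].
by exists (opensI U V), Wx, (res hU r), (res hU s), (res hV t); rewrite !germ_res.
Qed.

Definition stalk_lift2 (op : forall U, sec X U -> sec X U -> sec X U) (a b : stalk) : stalk :=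
  let U := pg_dom (repr a) in let V := pg_dom (repr b) in
  germ (conj (pg_mem (repr a)) (pg_mem (repr b)) : opensI U V x)
    (op _ (res (@opensIl _ U V) (pg_sec (repr a)))
          (res (@opensIr _ U V) (pg_sec (repr b)))).

Lemma stalk_lift2E (op : forall U, sec X U -> sec X U -> sec X U)
  (opE : forall (U V : opens X) (h : V `<=` U) s t,
     res h (op U s t) = op V (res h s) (res h t))
  (U : opens X) (Ux : U x) s t :
  stalk_lift2 op (germ Ux s) (germ Ux t) = germ Ux (op U s t).
Proof.
rewrite /stalk_lift2.
have E (u : stalk) : germ (pg_mem (repr u)) (pg_sec (repr u)) = u.
  by rewrite -[RHS]reprK; congr (\pi_ _ _); case: (repr u).
have /germ_eqP := E (germ Ux s) => -[W [h1 [h2 [Wx e]]]].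
have /germ_eqP := E (germ Ux t) => -[W' [h1' [h2' [Wx' e']]]].
set a := repr _ in h1 e *; set b := repr _ in h1' e' *.
apply/germ_eqP.
have k1 : opensI W W' `<=` opensI (pg_dom a) (pg_dom b) by apply: setISS.
have k2 : opensI W W' `<=` U by move=> y [/h2].
exists (opensI W W'), k1, k2; split=> //.
have l : opensI W W' `<=` W by apply: subIsetl.
have l' : opensI W W' `<=` W' by apply: subIsetr.
rewrite !opE; congr op.
  rewrite (res_comp _ _ (subset_trans l h1)) -(res_comp h1 l) e.
  exact: res_comp.
rewrite (res_comp _ _ (subset_trans l' h1')) -(res_comp h1' l') e'.
exact: res_comp.
Qed.

Definition stalk_zero : stalk := germ (I : opensT X x) 0.
Definition stalk_one : stalk := germ (I : opensT X x) 1.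
Definition stalk_opp (a : stalk) : stalk :=
  germ (pg_mem (repr a)) (- pg_sec (repr a)).
Definition stalk_add : stalk -> stalk -> stalk := stalk_lift2 (fun U s t => s + t).
Definition stalk_mul : stalk -> stalk -> stalk := stalk_lift2 (fun U s t => s * t).

Lemma stalk_zeroE (U : opens X) (Ux : U x) : stalk_zero = germ Ux 0.
Proof.
have h : U `<=` opensT X by [].
by rewrite /stalk_zero -(germ_res _ Ux h) rmorph0.
Qed.

Lemma stalk_oneE (U : opens X) (Ux : U x) : stalk_one = germ Ux 1.
Proof.
have h : U `<=` opensT X by [].
by rewrite /stalk_one -(germ_res _ Ux h) rmorph1.
Qed.

Lemma stalk_oppE (U : opens X) (Ux : U x) s : stalk_opp (germ Ux s) = germ Ux (- s).
Proof.
rewrite /stalk_opp.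
have /germ_eqP : germ (pg_mem (repr (germ Ux s))) (pg_sec (repr (germ Ux s))) = germ Ux s.
  by rewrite -[RHS]reprK; congr (\pi_ _ _); case: (repr _).
move=> [W [h1 [h2 [Wx e]]]].
by apply/germ_eqP; exists W, h1, h2; rewrite !rmorphN e.
Qed.

Lemma stalk_addE (U : opens X) (Ux : U x) s t :
  stalk_add (germ Ux s) (germ Ux t) = germ Ux (s + t).
Proof. by apply: stalk_lift2E => *; exact: rmorphD. Qed.

Lemma stalk_mulE (U : opens X) (Ux : U x) s t :
  stalk_mul (germ Ux s) (germ Ux t) = germ Ux (s * t).
Proof. by apply: stalk_lift2E => *; exact: rmorphM. Qed.

Lemma stalk_addA : associative stalk_add.
Proof.
move=> a b c; have [U [Ux [r [s [t [-> -> ->]]]]]] := germ_surj3 a b c.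
by rewrite !stalk_addE addrA.
Qed.

Lemma stalk_addC : commutative stalk_add.
Proof.
move=> a b; have [U [Ux [r [s [-> ->]]]]] := germ_surj2 a b.
by rewrite !stalk_addE addrC.
Qed.

Lemma stalk_add0 : left_id stalk_zero stalk_add.
Proof.
move=> a; have [U [Ux [r ->]]] := germ_surj a.
by rewrite (stalk_zeroE Ux) stalk_addE add0r.
Qed.

Lemma stalk_addN : left_inverse stalk_zero stalk_opp stalk_add.
Proof.
move=> a; have [U [Ux [r ->]]] := germ_surj a.
by rewrite (stalk_zeroE Ux) stalk_oppE stalk_addE addNr.
Qed.

HB.instance Definition _ := GRing.isZmodule.Build stalk
  stalk_addA stalk_addC stalk_add0 stalk_addN.

Lemma stalk_mulA : associative stalk_mul.
Proof.
move=> a b c; have [U [Ux [r [s [t [-> -> ->]]]]]] := germ_surj3 a b c.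
by rewrite !stalk_mulE mulrA.
Qed.

Lemma stalk_mulC : commutative stalk_mul.
Proof.
move=> a b; have [U [Ux [r [s [-> ->]]]]] := germ_surj2 a b.
by rewrite !stalk_mulE mulrC.
Qed.

Lemma stalk_mul1 : left_id stalk_one stalk_mul.
Proof.
move=> a; have [U [Ux [r ->]]] := germ_surj a.
by rewrite (stalk_oneE Ux) stalk_mulE mul1r.
Qed.

Lemma stalk_mulD : left_distributive stalk_mul stalk_add.
Proof.
move=> a b c; have [U [Ux [r [s [t [-> -> ->]]]]]] := germ_surj3 a b c.
by rewrite !(stalk_mulE, stalk_addE) mulrDl.
Qed.

HB.instance Definition _ := GRing.Zmodule_isComPzRing.Build stalk
  stalk_mulA stalk_mulC stalk_mul1 stalk_mulD.

Section GermMorphism.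
Variables (U : opens X) (Ux : U x).

Lemma germ_is_zmod_morphism : zmod_morphism (germ Ux).
Proof. by move=> s t; rewrite -stalk_addE -stalk_oppE. Qed.

Lemma germ_is_monoid_morphism : monoid_morphism (germ Ux).
Proof. by split=> [|s t]; rewrite -?stalk_oneE -?stalk_mulE. Qed.

HB.instance Definition _ := GRing.isZmodMorphism.Build _ _ (germ Ux)
  germ_is_zmod_morphism.
HB.instance Definition _ := GRing.isMonoidMorphism.Build _ _ (germ Ux)
  germ_is_monoid_morphism.
End GermMorphism.

End Stalk.
Arguments germ {X x U} Ux s.

(* Sections with equal germs everywhere are equal. *)
Lemma sec_germ_inj (X : ringedSpace) (U : opens X) (s t : sec X U) :
  (forall x (Ux : U x), germ Ux s = germ Ux t) -> s = t.
Proof.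
move=> E.
have H (y : {x | U x}) : exists W : opens X, exists h : W `<=` U,
    W (sval y) /\ res h s = res h t.
  case: y => y Uy /=; have /germ_eqP[W [h [h' [Wy e]]]] := E y Uy.
  by exists W, h; split=> //; rewrite e (Prop_irrelevance h' h).
pose W y := sval (cid (H y)).
have hW y : W y `<=` U by rewrite /W; case: cid => W' [].
apply: (res_inj (V := W) (hV := hW)) => [y Uy|y].
  exists (exist _ y Uy) => //; rewrite /W; by case: cid => W' [h []].
move: (hW y); rewrite /W; case: cid => W' [h [_ e]] /= h'.
by rewrite (Prop_irrelevance h' h).
Qed.

Lemma rmorphism_eq (R S : pzRingType) (f g : {rmorphism R -> S}) : f =1 g -> f = g.
Proof.
case: f g => [f [[f0] [f1]]] [g [[g0] [g1]]] /= /funext E; rewrite /= in E.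
by subst g; congr GRing.RMorphism.Pack; congr GRing.RMorphism.Class;
  congr (_ _); exact: Prop_irrelevance.
Qed.

Lemma opens_preim_sub (X Y : topologicalType) (f : X -> Y) (fc : continuous f)
  (U V : opens Y) : V `<=` U -> opens_preim fc V `<=` opens_preim fc U.
Proof. by move=> VU x; exact: VU. Qed.
Arguments opens_preim_sub {X Y f} fc {U V} h.

Record rsmorphism (X Y : ringedSpace) := RSMorphism {
  base :> X -> Y;
  base_cont : continuous base;
  comap : forall V : opens Y, {rmorphism sec Y V -> sec X (opens_preim base_cont V)};
  comap_res : forall (U V : opens Y) (h : V `<=` U) s,
    comap V (res h s) = res (opens_preim_sub base_cont h) (comap U s)
}.
Arguments base_cont {X Y} f : rename.
Arguments comap {X Y} f V : rename.

Section StalkMap.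
Variables (X Y : ringedSpace) (f : rsmorphism X Y) (x : X).

Definition stalk_map (a : stalk (f x)) : stalk x :=
  @germ X x (opens_preim (base_cont f) (pg_dom (repr a))) (pg_mem (repr a))
    (comap f _ (pg_sec (repr a))).

Lemma stalk_map_germ (V : opens Y) (Vx : V (f x)) (s : sec Y V) :
  stalk_map (germ Vx s) = @germ X x (opens_preim (base_cont f) V) Vx (comap f V s).
Proof.
rewrite /stalk_map.
have /germ_eqP[W [h1 [h2 [Wx e]]]] :
    germ (pg_mem (repr (germ Vx s))) (pg_sec (repr (germ Vx s))) = germ Vx s.
  by rewrite -[RHS]reprK; congr (\pi_ _ _); case: (repr _).
apply/germ_eqP; exists (opens_preim (base_cont f) W).
by exists (opens_preim_sub _ h1), (opens_preim_sub _ h2); rewrite -!comap_res e.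
Qed.

Lemma stalk_map_is_zmod_morphism : zmod_morphism stalk_map.
Proof.
move=> a b; have [V [Vx [s [t [-> ->]]]]] := germ_surj2 a b.
by rewrite -rmorphB !stalk_map_germ -rmorphB -rmorphB.
Qed.

Lemma stalk_map_is_monoid_morphism : monoid_morphism stalk_map.
Proof.
split=> [|a b].
  rewrite -(rmorph1 (@germ Y (f x) (opensT Y) I)) stalk_map_germ.
  by rewrite rmorph1 rmorph1.
have [V [Vx [s [t [-> ->]]]]] := germ_surj2 a b.
by rewrite -rmorphM !stalk_map_germ -rmorphM -rmorphM.
Qed.

HB.instance Definition _ := GRing.isZmodMorphism.Build _ _ stalk_map
  stalk_map_is_zmod_morphism.
HB.instance Definition _ := GRing.isMonoidMorphism.Build _ _ stalk_map
  stalk_map_is_monoid_morphism.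
End StalkMap.
Arguments stalk_map {X Y} f x a.
Arguments stalk_map_germ {X Y} f {x V} Vx s.

Definition local_hom (R S : comPzRingType) (f : R -> S) : Prop :=
  forall a, invertible (f a) -> invertible a.

(* Between locally ringed spaces, these are the morphisms of locally ringed
   spaces; in particular, between schemes, the morphisms of schemes. *)
Record morphism (X Y : ringedSpace) := Morphism {
  rsmap :> rsmorphism X Y;
  stalk_local : forall x, local_hom (stalk_map rsmap x)
}.

Lemma morphism_eq (X Y : ringedSpace) (f g : morphism X Y) :
  (forall x, f x = g x) ->
  (forall (V : opens Y) (s : sec Y V) x (fx : V (f x)) (gx : V (g x)),
     @germ X x (opens_preim (base_cont f) V) fx (comap f V s) =
     @germ X x (opens_preim (base_cont g) V) gx (comap g V s)) ->
  f = g.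
Proof.
case: f g => [[f fc fm fr] fl] [[g gc gm gr] gl] /= /funext E; subst g.
rewrite (Prop_irrelevance gc fc) in gm gr gl * => {gc} E.
have Em : fm = gm.
  apply: functional_extensionality_dep => V; apply: rmorphism_eq => s.
  by apply: sec_germ_inj => x Vx; exact: E.
subst gm; rewrite (Prop_irrelevance gr fr) in gl *.
by rewrite (Prop_irrelevance gl fl).
Qed.

Section Comp.
Variables (X Y Z : ringedSpace) (g : morphism Y Z) (f : morphism X Y).

Lemma comp_cont : continuous (g \o f).
Proof. by move=> x; apply: continuous_comp; exact: base_cont. Qed.

Lemma comp_preim (V : opens Z) :
  opens_preim comp_cont V `<=` opens_preim (base_cont f) (opens_preim (base_cont g) V).
Proof. by []. Qed.

Definition comp_comap (V : opens Z) :
    {rmorphism sec Z V -> sec X (opens_preim comp_cont V)} :=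
  res (@comp_preim V) \o comap f _ \o comap g V.

Lemma comp_comap_res (U V : opens Z) (h : V `<=` U) s :
  comp_comap V (res h s) = res (opens_preim_sub comp_cont h) (comp_comap U s).
Proof.
rewrite /comp_comap /= !comap_res.
have k : opens_preim comp_cont V `<=` opens_preim (base_cont f) (opens_preim (base_cont g) U).
  by move=> x; exact: h.
by rewrite (res_comp _ _ k) (res_comp _ _ k).
Qed.

Definition comp_rs : rsmorphism X Z := RSMorphism comp_comap_res.

Lemma comp_stalk_map x a : stalk_map comp_rs x a = stalk_map f x (stalk_map g (f x) a).
Proof.
have [V [Vx [s ->]]] := germ_surj a.
rewrite (stalk_map_germ comp_rs) (stalk_map_germ g).
rewrite (stalk_map_germ f (V := opens_preim (base_cont g) V)).
exact: germ_res.
Qed.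

Lemma comp_local x : local_hom (stalk_map comp_rs x).
Proof. by move=> a; rewrite comp_stalk_map => /stalk_local/stalk_local. Qed.

Definition mcomp : morphism X Z := Morphism comp_local.
End Comp.

Record primeSpec (A : comPzRingType) := PrimeSpec {
  prime_set :> set A;
  prime0 : prime_set 0;
  primeD : forall a b, prime_set a -> prime_set b -> prime_set (a + b);
  primeMl : forall a b, prime_set b -> prime_set (a * b);
  prime1 : ~ prime_set 1;
  primeM : forall a b, prime_set (a * b) -> prime_set a \/ prime_set b
}.

Section Localization.
Variables (A : comPzRingType) (P : primeSpec A).

Lemma notin_primeM (s t : A) : ~ P s -> ~ P t -> ~ P (s * t).
Proof. by move=> ns nt /primeM[]. Qed.

Record fraction := Fraction { frac_num : A; frac_den : A; frac_denP : ~ P frac_den }.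

HB.instance Definition _ := gen_eqMixin fraction.
HB.instance Definition _ := gen_choiceMixin fraction.

Definition frac_rel (x y : fraction) : Prop :=
  exists2 t, ~ P t & t * (frac_num x * frac_den y) = t * (frac_num y * frac_den x).

Definition frac_relb (x y : fraction) : bool := `[< frac_rel x y >].

Lemma frac_relb_equiv : equiv_class_of frac_relb.
Proof.
split=> [x|x y|y x z].
- by apply/asboolP; exists 1; [exact: prime1|].
- by apply/asboolP/asboolP => -[t nt E]; exists t.
- move=> /asboolP[t nt E] /asboolP[u nu F]; apply/asboolP.
  exists (t * u * frac_den y).
    by apply: notin_primeM; [exact: notin_primeM|exact: frac_denP].
  transitivity (u * frac_den z * (t * (frac_num x * frac_den y))); first ring.
  rewrite E.
  transitivity (t * frac_den x * (u * (frac_num y * frac_den z))); first ring.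
  by rewrite F; ring.
Qed.

Canonical frac_equiv := EquivRelPack frac_relb_equiv.

Definition localization := {eq_quot frac_equiv}.
HB.instance Definition _ := Choice.on localization.

Definition frac (a s : A) (ns : ~ P s) : localization :=
  \pi_localization (Fraction a ns).

Lemma frac_eqP a s (ns : ~ P s) b t (nt : ~ P t) :
  frac a ns = frac b nt <-> exists2 u, ~ P u & u * (a * t) = u * (b * s).
Proof. by split=> [/eqmodP/asboolP //|h]; apply/eqmodP/asboolP. Qed.

Lemma frac_surj (x : localization) : exists a s (ns : ~ P s), x = frac a ns.
Proof.
exists (frac_num (repr x)), (frac_den (repr x)), (@frac_denP (repr x)).
by rewrite -[LHS]reprK; congr (\pi_ _ _); case: (repr x).
Qed.

Lemma frac_repr (x : localization) :
  frac (frac_num (repr x)) (@frac_denP (repr x)) = x.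
Proof. by rewrite -[RHS]reprK; congr (\pi_ _ _); case: (repr x). Qed.

Definition loc_zero : localization := frac 0 (@prime1 A P).
Definition loc_one : localization := frac 1 (@prime1 A P).
Definition loc_opp (x : localization) : localization :=
  frac (- frac_num (repr x)) (@frac_denP (repr x)).
Definition loc_add (x y : localization) : localization :=
  frac (frac_num (repr x) * frac_den (repr y) + frac_num (repr y) * frac_den (repr x))
    (notin_primeM (@frac_denP (repr x)) (@frac_denP (repr y))).
Definition loc_mul (x y : localization) : localization :=
  frac (frac_num (repr x) * frac_num (repr y))
    (notin_primeM (@frac_denP (repr x)) (@frac_denP (repr y))).

Lemma loc_oppE a s (ns : ~ P s) : loc_opp (frac a ns) = frac (- a) ns.
Proof.
have /frac_eqP[u nu E] := frac_repr (frac a ns).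
by apply/frac_eqP; exists u => //; rewrite !mulNr !mulrN E.
Qed.

Lemma loc_addE a s (ns : ~ P s) b t (nt : ~ P t) :
  loc_add (frac a ns) (frac b nt) = frac (a * t + b * s) (notin_primeM ns nt).
Proof.
have /frac_eqP[u nu E] := frac_repr (frac a ns).
have /frac_eqP[v nv F] := frac_repr (frac b nt).
rewrite /loc_add.
set a' := frac_num _ in E *; set s' := frac_den _ in E *.
set b' := frac_num _ in F *; set t' := frac_den _ in F *.
apply/frac_eqP; exists (u * v); first exact: notin_primeM.
transitivity (v * t * t' * (u * (a' * s)) + u * s * s' * (v * (b' * t))); first ring.
by rewrite E F; ring.
Qed.

Lemma loc_mulE a s (ns : ~ P s) b t (nt : ~ P t) :
  loc_mul (frac a ns) (frac b nt) = frac (a * b) (notin_primeM ns nt).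
Proof.
have /frac_eqP[u nu E] := frac_repr (frac a ns).
have /frac_eqP[v nv F] := frac_repr (frac b nt).
rewrite /loc_mul.
set a' := frac_num _ in E *; set s' := frac_den _ in E *.
set b' := frac_num _ in F *; set t' := frac_den _ in F *.
apply/frac_eqP; exists (u * v); first exact: notin_primeM.
transitivity ((u * (a' * s)) * (v * (b' * t))); first ring.
by rewrite E F; ring.
Qed.

Lemma frac_eq a s (ns : ~ P s) b t (nt : ~ P t) :
  a * t = b * s -> frac a ns = frac b nt.
Proof. by move=> E; apply/frac_eqP; exists 1; [exact: prime1|rewrite E]. Qed.

Lemma loc_addA : associative loc_add.
Proof.
move=> x y z; have [a [s [ns ->]]] := frac_surj x.
have [b [t [nt ->]]] := frac_surj y; have [c [u [nu ->]]] := frac_surj z.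
by rewrite !loc_addE; apply: frac_eq; ring.
Qed.

Lemma loc_addC : commutative loc_add.
Proof.
move=> x y; have [a [s [ns ->]]] := frac_surj x; have [b [t [nt ->]]] := frac_surj y.
by rewrite !loc_addE; apply: frac_eq; ring.
Qed.

Lemma loc_add0 : left_id loc_zero loc_add.
Proof.
by move=> x; have [a [s [ns ->]]] := frac_surj x; rewrite loc_addE; apply: frac_eq; ring.
Qed.

Lemma loc_addN : left_inverse loc_zero loc_opp loc_add.
Proof.
move=> x; have [a [s [ns ->]]] := frac_surj x.
by rewrite loc_oppE loc_addE; apply: frac_eq; ring.
Qed.

HB.instance Definition _ := GRing.isZmodule.Build localization
  loc_addA loc_addC loc_add0 loc_addN.

Lemma loc_mulA : associative loc_mul.
Proof.
move=> x y z; have [a [s [ns ->]]] := frac_surj x.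
have [b [t [nt ->]]] := frac_surj y; have [c [u [nu ->]]] := frac_surj z.
by rewrite !loc_mulE; apply: frac_eq; ring.
Qed.

Lemma loc_mulC : commutative loc_mul.
Proof.
move=> x y; have [a [s [ns ->]]] := frac_surj x; have [b [t [nt ->]]] := frac_surj y.
by rewrite !loc_mulE; apply: frac_eq; ring.
Qed.

Lemma loc_mul1 : left_id loc_one loc_mul.
Proof.
by move=> x; have [a [s [ns ->]]] := frac_surj x; rewrite loc_mulE; apply: frac_eq; ring.
Qed.

Lemma loc_mulD : left_distributive loc_mul loc_add.
Proof.
move=> x y z; have [a [s [ns ->]]] := frac_surj x.
have [b [t [nt ->]]] := frac_surj y; have [c [u [nu ->]]] := frac_surj z.
by rewrite !(loc_mulE, loc_addE); apply: frac_eq; ring.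
Qed.

HB.instance Definition _ := GRing.Zmodule_isComPzRing.Build localization
  loc_mulA loc_mulC loc_mul1 loc_mulD.

Lemma frac0 s (ns : ~ P s) : frac 0 ns = 0.
Proof. by apply: frac_eq; ring. Qed.

Lemma frac1 s (ns : ~ P s) : frac s ns = 1.
Proof. by apply: frac_eq; ring. Qed.

Lemma fracN a s (ns : ~ P s) : - frac a ns = frac (- a) ns.
Proof. exact: loc_oppE. Qed.

Lemma fracD a s (ns : ~ P s) b t (nt : ~ P t) :
  frac a ns + frac b nt = frac (a * t + b * s) (notin_primeM ns nt).
Proof. exact: loc_addE. Qed.

Lemma fracM a s (ns : ~ P s) b t (nt : ~ P t) :
  frac a ns * frac b nt = frac (a * b) (notin_primeM ns nt).
Proof. exact: loc_mulE. Qed.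

Lemma frac_invertible a s (ns : ~ P s) : invertible (frac a ns) <-> ~ P a.
Proof.
split=> [[y]|na].
  have [b [t [nt ->]]] := frac_surj y; rewrite fracM => /frac_eqP[u nu E] Pa.
  have : P (u * (1 * (s * t))).
    rewrite -E mulr1; apply: primeMl; rewrite mulrC; exact: primeMl.
  by rewrite mul1r; apply: notin_primeM => //; exact: notin_primeM.
by exists (frac s na); rewrite fracM; apply: frac_eq; ring.
Qed.
End Localization.
Arguments frac {A} P a s ns : rename.
Arguments localization {A} P.

Section ZariskiTopology.
Variable A : comPzRingType.
HB.instance Definition _ := gen_eqMixin (primeSpec A).
HB.instance Definition _ := gen_choiceMixin (primeSpec A).

(* The complements of the closed sets V(E). *)
Definition zariski_open : set_system (primeSpec A) :=
  [set U | exists E : set A, U = [set P : primeSpec A | ~ (E `<=` P)]].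

Lemma zariski_openT : zariski_open setT.
Proof.
exists setT; apply/esym/seteqP; split=> P // _ h; apply: (@prime1 A P); exact: h.
Qed.

Lemma zariski_openI : setI_closed zariski_open.
Proof.
move=> _ _ [E ->] [F ->]; exists [set c | exists a b, [/\ E a, F b & c = a * b]].
apply/seteqP; split=> P /=.
  move=> [/existsNP[a /not_implyP[Ea nPa]] /existsNP[b /not_implyP[Fb nPb]]] h.
  by apply: (notin_primeM nPa nPb); apply: h; exists a, b.
move=> nP; split=> h; apply: nP => _ [a [b [Ea Fb ->]]].
  by rewrite mulrC; apply: primeMl; exact: h.
by apply: primeMl; exact: h.
Qed.

Lemma zariski_openU (I : Type) (U : I -> set (primeSpec A)) :
  (forall i, zariski_open (U i)) -> zariski_open (\bigcup_i U i).
Proof.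
move=> /choice[E UE]; exists (\bigcup_i E i); apply/seteqP; split=> P /=.
  by move=> [i _]; rewrite UE /= => nP h; apply: nP => a Ea; apply: h; exists i.
move=> /existsNP[a /not_implyP[[i _ Ea] nPa]].
by exists i => //; rewrite UE /= => /(_ a Ea).
Qed.

HB.instance Definition _ := isOpenTopological.Build (primeSpec A)
  zariski_openT zariski_openI zariski_openU.

Definition basicOpen (f : A) : opens (primeSpec A).
Proof.
refine (@Opens (primeSpec A) [set P : primeSpec A | ~ P f] _).
exists [set f]; apply/seteqP; split=> P /=; first by move=> nP /(_ f erefl).
by move=> h Pf; apply: h => _ ->.
Defined.

End ZariskiTopology.

Section StructureSheaf.
Variable A : comPzRingType.
Local Notation X := (primeSpec A).

Definition locally_fraction (U : opens X) (s : forall P : X, U P -> localization P) :=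
  forall P : X, U P -> exists V : opens X, [/\ V P, V `<=` U &
    exists a f : A, forall (Q : X) (UQ : U Q), V Q ->
      exists nf : ~ Q f, s Q UQ = frac Q a f nf].

Record specSec (U : opens X) := SpecSec {
  spec_val :> forall P : X, U P -> localization P;
  spec_valP : locally_fraction spec_val
}.

Section Ring.
Variable U : opens X.
HB.instance Definition _ := gen_eqMixin (specSec U).
HB.instance Definition _ := gen_choiceMixin (specSec U).

Lemma specSecP (s t : specSec U) : (forall P UP, s P UP = t P UP) -> s = t.
Proof.
case: s t => [s hs] [t ht] /= E.
have Est : s = t.
  apply: functional_extensionality_dep => P.
  by apply: functional_extensionality_dep => UP.
by subst t; rewrite (Prop_irrelevance hs ht).
Qed.

Lemma spec_const_subproof (a : A) :
  locally_fraction (fun (P : X) (_ : U P) => frac P a 1 (@prime1 A P)).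
Proof.
by move=> P UP; exists U; split=> //; exists a, 1 => Q _ _; exists (@prime1 A Q).
Qed.

Definition spec_const (a : A) : specSec U := SpecSec (@spec_const_subproof a).

Lemma spec_opp_subproof (s : specSec U) :
  locally_fraction (fun P UP => - s P UP).
Proof.
move=> P UP; have [V [VP VU [a [f E]]]] := spec_valP s UP.
exists V; split=> //; exists (- a), f => Q UQ VQ; have [nf ->] := E Q UQ VQ.
by exists nf; rewrite fracN.
Qed.

Lemma spec_add_subproof (s t : specSec U) :
  locally_fraction (fun P UP => s P UP + t P UP).
Proof.
move=> P UP; have [V [VP VU [a [f E]]]] := spec_valP s UP.
have [W [WP WU [b [g F]]]] := spec_valP t UP.
exists (opensI V W); split=> //; first by move=> Q [/VU].
exists (a * g + b * f), (f * g) => Q UQ [VQ WQ].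
have [nf ->] := E Q UQ VQ; have [ng ->] := F Q UQ WQ.
by exists (notin_primeM nf ng); rewrite fracD.
Qed.

Lemma spec_mul_subproof (s t : specSec U) :
  locally_fraction (fun P UP => s P UP * t P UP).
Proof.
move=> P UP; have [V [VP VU [a [f E]]]] := spec_valP s UP.
have [W [WP WU [b [g F]]]] := spec_valP t UP.
exists (opensI V W); split=> //; first by move=> Q [/VU].
exists (a * b), (f * g) => Q UQ [VQ WQ].
have [nf ->] := E Q UQ VQ; have [ng ->] := F Q UQ WQ.
by exists (notin_primeM nf ng); rewrite fracM.
Qed.

Definition spec_opp (s : specSec U) := SpecSec (@spec_opp_subproof s).
Definition spec_add (s t : specSec U) := SpecSec (@spec_add_subproof s t).
Definition spec_mul (s t : specSec U) := SpecSec (@spec_mul_subproof s t).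

Lemma spec_addA : associative spec_add.
Proof. by move=> s t u; apply: specSecP => P UP /=; rewrite addrA. Qed.
Lemma spec_addC : commutative spec_add.
Proof. by move=> s t; apply: specSecP => P UP /=; rewrite addrC. Qed.
Lemma spec_add0 : left_id (spec_const 0) spec_add.
Proof. by move=> s; apply: specSecP => P UP /=; rewrite frac0 add0r. Qed.
Lemma spec_addN : left_inverse (spec_const 0) spec_opp spec_add.
Proof. by move=> s; apply: specSecP => P UP /=; rewrite frac0 addNr. Qed.

HB.instance Definition _ := GRing.isZmodule.Build (specSec U)
  spec_addA spec_addC spec_add0 spec_addN.

Lemma spec_mulA : associative spec_mul.
Proof. by move=> s t u; apply: specSecP => P UP /=; rewrite mulrA. Qed.
Lemma spec_mulC : commutative spec_mul.
Proof. by move=> s t; apply: specSecP => P UP /=; rewrite mulrC. Qed.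
Lemma spec_mul1 : left_id (spec_const 1) spec_mul.
Proof. by move=> s; apply: specSecP => P UP /=; rewrite frac1 mul1r. Qed.
Lemma spec_mulD : left_distributive spec_mul spec_add.
Proof. by move=> s t u; apply: specSecP => P UP /=; rewrite mulrDl. Qed.

HB.instance Definition _ := GRing.Zmodule_isComPzRing.Build (specSec U)
  spec_mulA spec_mulC spec_mul1 spec_mulD.

Lemma spec_const_is_zmod_morphism : zmod_morphism spec_const.
Proof.
move=> a b; apply: specSecP => P UP /=.
rewrite fracN fracD; apply: frac_eq; ring.
Qed.

Lemma spec_const_is_monoid_morphism : monoid_morphism spec_const.
Proof.
by split=> [//|a b]; apply: specSecP => P UP /=; rewrite fracM; apply: frac_eq; ring.
Qed.

HB.instance Definition _ := GRing.isZmodMorphism.Build _ _ spec_const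
  spec_const_is_zmod_morphism.
HB.instance Definition _ := GRing.isMonoidMorphism.Build _ _ spec_const
  spec_const_is_monoid_morphism.

End Ring.

Section Restriction.
Variables (U V : opens X) (h : V `<=` U).

Lemma spec_res_subproof (s : specSec U) :
  locally_fraction (fun (P : X) (VP : V P) => s P (h VP)).
Proof.
move=> P VP; have [W [WP WU [a [f E]]]] := spec_valP s (h VP).
exists (opensI V W); split=> //; first exact: opensIl.
by exists a, f => Q VQ [_ WQ]; exact: E.
Qed.

Definition spec_res (s : specSec U) : specSec V := SpecSec (@spec_res_subproof s).

Lemma spec_res_is_zmod_morphism : zmod_morphism spec_res.
Proof. by move=> s t; exact: specSecP. Qed.
Lemma spec_res_is_monoid_morphism : monoid_morphism spec_res.
Proof. by split=> [|s t]; exact: specSecP. Qed.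

HB.instance Definition _ := GRing.isZmodMorphism.Build _ _ spec_res
  spec_res_is_zmod_morphism.
HB.instance Definition _ := GRing.isMonoidMorphism.Build _ _ spec_res
  spec_res_is_monoid_morphism.
End Restriction.

Lemma spec_res_id (U : opens X) (h : U `<=` U) (s : specSec U) : spec_res h s = s.
Proof.
by apply: specSecP => P UP /=; congr (spec_val _ _); exact: Prop_irrelevance.
Qed.

Lemma spec_res_comp (U V W : opens X) (hVU : V `<=` U) (hWV : W `<=` V)
  (hWU : W `<=` U) (s : specSec U) : spec_res hWV (spec_res hVU s) = spec_res hWU s.
Proof.
by apply: specSecP => P UP /=; congr (spec_val _ _); exact: Prop_irrelevance.
Qed.

Lemma spec_res_inj (U : opens X) (I : Type) (V : I -> opens X)
    (hV : forall i, V i `<=` U) : U `<=` \bigcup_i V i ->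
  forall s t : specSec U,
  (forall i, spec_res (hV i) s = spec_res (hV i) t) -> s = t.
Proof.
move=> cover s t E; apply: specSecP => P UP; have [i _ VP] := cover P UP.
have := congr1 (fun r : specSec (V i) => r P VP) (E i).
by rewrite /= (Prop_irrelevance (hV i P VP) UP).
Qed.

Lemma spec_res_glue (U : opens X) (I : Type) (V : I -> opens X)
    (hV : forall i, V i `<=` U) : U `<=` \bigcup_i V i ->
  forall s : (forall i, specSec (V i)),
  (forall i j (W : opens X) (hi : W `<=` V i) (hj : W `<=` V j),
     spec_res hi (s i) = spec_res hj (s j)) ->
  exists t : specSec U, forall i, spec_res (hV i) t = s i.
Proof.
move=> cover s E.
have c (P : X) (UP : U P) : {i | V i P}.
  by apply: cid; have [i _ VP] := cover P UP; exists i.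
have sE i j (P : X) (Pi : V i P) (Pj : V j P) : s i P Pi = s j P Pj.
  pose W := opensI (V i) (V j); have WP : W P by [].
  have := E i j W (@opensIl _ _ _) (@opensIr _ _ _).
  move=> /(congr1 (fun r : specSec W => r P WP)) /=.
  by rewrite (Prop_irrelevance (opensIl WP) Pi) (Prop_irrelevance (opensIr WP) Pj).
have tP : locally_fraction (fun P UP => s (sval (c P UP)) P (svalP (c P UP))).
  move=> P UP; move: (c P UP) => [i VP].
  have [W [WP WV [a [f F]]]] := spec_valP (s i) VP.
  exists W; split=> //; first by move=> Q /WV/hV.
  exists a, f => Q UQ WQ; have [nf e] := F Q (WV Q WQ) WQ.
  by exists nf; rewrite -e; exact: sE.
by exists (SpecSec tP) => i; apply: specSecP => P VP /=; exact: sE.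
Qed.

Definition Spec : ringedSpace :=
  @RingedSpace X specSec spec_res spec_res_id spec_res_comp spec_res_inj spec_res_glue.

(* A section of the structure sheaf has invertible germ at P as soon as its
   value in the localization at P is invertible. *)
Lemma spec_germ_invertible (U : opens Spec) (P : Spec) (UP : U P) (s : sec Spec U) :
  invertible (germ UP s) <-> invertible ((s : specSec U) P UP).
Proof.
split=> [[b]|inv].
  have [V [VP [t ->]]] := germ_surj b.
  pose W := opensI U V; have WP : W P by [].
  rewrite -(germ_res UP WP (@opensIl _ _ _)) -(germ_res VP WP (@opensIr _ _ _)).
  rewrite -rmorphM -(rmorph1 (germ WP)) => /germ_eqP[W' [h [h' [W'P e]]]].
  exists ((t : specSec V) P VP).
  move: (congr1 (fun r : specSec W' => r P W'P) e) => /=.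
  rewrite (Prop_irrelevance (opensIl (h P W'P)) UP) (Prop_irrelevance (opensIr (h P W'P)) VP).
  by rewrite frac1.
have [V [VP VU [a [f E]]]] := spec_valP (s : specSec U) UP.
have [nf e] := E P UP VP; move: inv; rewrite e => /frac_invertible na.
pose W : opens Spec := opensI V (basicOpen a).
have WP : W P by [].
have tP : @locally_fraction W (fun (Q : X) (WQ : W Q) => frac Q f a (proj2 WQ)).
  move=> Q WQ; exists W; split=> //; exists f, a => Q' WQ' _; by exists (proj2 WQ').
exists (germ WP (SpecSec tP : sec Spec W)).
have WU : W `<=` U by move=> Q [/VU].
rewrite -(germ_res UP WP WU) -rmorphM -(rmorph1 (germ WP)); congr germ.
apply: specSecP => Q WQ /=; have [nf' ->] := E Q (WU Q WQ) (proj1 WQ).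
by rewrite fracM; apply: frac_eq; ring.
Qed.

End StructureSheaf.

Section SpecMap.
Variables (A B : comPzRingType) (f : {rmorphism A -> B}).

Definition spec_base (Q : Spec B) : Spec A.
Proof.
refine (@PrimeSpec A [set a | (Q : primeSpec B) (f a)] _ _ _ _ _) => /=.
- by rewrite rmorph0; exact: prime0.
- by move=> a b Qa Qb; rewrite rmorphD; exact: primeD.
- by move=> a b Qb; rewrite rmorphM; exact: primeMl.
- by rewrite rmorph1; exact: prime1.
- by move=> a b; rewrite rmorphM; exact: primeM.
Defined.

Lemma spec_base_cont : continuous spec_base.
Proof.
apply/continuousP => _ [E ->]; exists (f @` E).
apply/seteqP; split=> Q /= nQ h; apply: nQ; first by move=> a Ea; apply: h; exists a.
by move=> _ [a Ea <-]; exact: h.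
Qed.

Section LocMap.
Variable Q : primeSpec B.
Local Notation P := (spec_base Q : primeSpec A).

Definition loc_map (x : localization P) : localization Q :=
  frac Q (f (frac_num (repr x))) (f (frac_den (repr x))) (@frac_denP _ _ (repr x)).

Lemma loc_mapE a s (ns : ~ P s) : loc_map (frac P a s ns) = frac Q (f a) (f s) ns.
Proof.
have /frac_eqP[u nu E] := frac_repr (frac P a s ns).
by apply/frac_eqP; exists (f u); rewrite // -!rmorphM E.
Qed.

Lemma loc_map_is_zmod_morphism : zmod_morphism loc_map.
Proof.
move=> x y; have [a [s [ns ->]]] := frac_surj x; have [b [t [nt ->]]] := frac_surj y.
rewrite fracN fracD !loc_mapE fracN fracD; apply: frac_eq.
by rewrite !(rmorphD, rmorphN, rmorphM); ring.
Qed.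

Lemma loc_map_is_monoid_morphism : monoid_morphism loc_map.
Proof.
split=> [|x y]; first by rewrite -(frac1 (@prime1 A P)) loc_mapE frac1.
have [a [s [ns ->]]] := frac_surj x; have [b [t [nt ->]]] := frac_surj y.
by rewrite fracM !loc_mapE fracM; apply: frac_eq; rewrite !rmorphM.
Qed.

HB.instance Definition _ := GRing.isZmodMorphism.Build _ _ loc_map
  loc_map_is_zmod_morphism.
HB.instance Definition _ := GRing.isMonoidMorphism.Build _ _ loc_map
  loc_map_is_monoid_morphism.

Lemma loc_map_local : local_hom loc_map.
Proof.
move=> x; have [a [s [ns ->]]] := frac_surj x.
by rewrite loc_mapE => /frac_invertible na; apply/frac_invertible.
Qed.
End LocMap.

Section Comap.
Variable V : opens (Spec A).
Local Notation U := (opens_preim spec_base_cont V).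

Lemma spec_comap_subproof (s : specSec V) :
  @locally_fraction B U (fun Q UQ => loc_map (s (spec_base Q) UQ)).
Proof.
move=> Q UQ; have [W [WP WV [a [g E]]]] := spec_valP s (UQ : V (spec_base Q)).
exists (opens_preim spec_base_cont W); split=> //; first by move=> Q' /WV.
exists (f a), (f g) => Q' UQ' WQ'; have [ng ->] := E (spec_base Q') UQ' WQ'.
by exists ng; rewrite loc_mapE.
Qed.

Definition spec_comap (s : specSec V) : specSec U := SpecSec (@spec_comap_subproof s).

Lemma spec_comap_is_zmod_morphism : zmod_morphism spec_comap.
Proof. by move=> s t; apply: specSecP => Q UQ /=; rewrite -rmorphB. Qed.

Lemma spec_comap_is_monoid_morphism : monoid_morphism spec_comap.
Proof.
by split=> [|s t]; apply: specSecP => Q UQ /=; rewrite -?rmorphM // !frac1 rmorph1.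
Qed.

HB.instance Definition _ := GRing.isZmodMorphism.Build _ _ spec_comap
  spec_comap_is_zmod_morphism.
HB.instance Definition _ := GRing.isMonoidMorphism.Build _ _ spec_comap
  spec_comap_is_monoid_morphism.
End Comap.

Lemma spec_comap_res (U V : opens (Spec A)) (h : V `<=` U) (s : sec (Spec A) U) :
  spec_comap (res h s) = res (opens_preim_sub spec_base_cont h) (spec_comap s).
Proof.
apply: specSecP => Q UQ /=.
by rewrite (Prop_irrelevance (opens_preim_sub _ h Q UQ) (h _ UQ)).
Qed.

Definition Spec_rsmap : rsmorphism (Spec B) (Spec A) :=
  @RSMorphism (Spec B) (Spec A) spec_base spec_base_cont spec_comap spec_comap_res.

Lemma Spec_local Q : local_hom (stalk_map Spec_rsmap Q).
Proof.
move=> a; have [V [VP [s ->]]] := germ_surj a; rewrite stalk_map_germ.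
by move=> /spec_germ_invertible/loc_map_local inv; apply/spec_germ_invertible.
Qed.

Definition Spec_map : morphism (Spec B) (Spec A) := Morphism Spec_local.
End SpecMap.

Definition open_immersion (U X : ringedSpace) (j : morphism U X) : Prop :=
  [/\ injective j,
      forall V : opens U, open (j @` V) &
      forall V : opens X, V `<=` range j -> bijective (comap j V)].

Definition is_scheme (X : ringedSpace) : Prop :=
  forall x : X, exists (A : comPzRingType) (j : morphism (Spec A) X),
    open_immersion j /\ range j x.

Record scheme := Scheme {
  scheme_ringedSpace :> ringedSpace;
  schemeP : is_scheme scheme_ringedSpace
}.

Record schemeOver (R : comPzRingType) := SchemeOver {
  schemeOver_scheme :> scheme;
  str : morphism schemeOver_scheme (Spec R)
}.
Arguments str {R} X : rename.

Definition over_morphism (R : comPzRingType) (X Y : schemeOver R)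
  (f : morphism X Y) : Prop := mcomp (str Y) f = str X.

(* The element \sum_(i < m) n i (x) s i of the tensor product of N and S over R
   vanishes, S being an R-algebra through f: it is killed by every R-balanced
   biadditive map. *)
Definition tensor_eq0 (R S : comPzRingType) (f : {rmorphism R -> S})
    (N : lmodType R) (m : nat) (n : 'I_m -> N) (s : 'I_m -> S) : Prop :=
  forall (T : zmodType) (B : N -> S -> T),
    (forall u v t, B (u + v) t = B u t + B v t) ->
    (forall u t t', B u (t + t') = B u t + B u t') ->
    (forall r u t, B (r *: u) t = B u (f r * t)) ->
    \sum_(i < m) B (n i) (s i) = 0.

(* S is a flat R-module: tensoring with S preserves injectivity. *)
Definition flat_hom (R S : comPzRingType) (f : {rmorphism R -> S}) : Prop :=
  forall (N N' : lmodType R) (g : {linear N -> N'}), injective g ->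
  forall (m : nat) (n : 'I_m -> N) (s : 'I_m -> S),
    tensor_eq0 f (fun i => g (n i)) s -> tensor_eq0 f n s.

Definition flat (X Y : ringedSpace) (f : morphism X Y) : Prop :=
  forall x : X, flat_hom (stalk_map f x).

Section FrobeniusRing.
Variables (p : nat) (pp : prime p) (R : comPzRingType) (p0 : p%:R = 0 :> R).

Definition frob_fun (_ : prime p) (_ : p%:R = 0 :> R) (a : R) : R := a ^+ p.
Local Notation frob := (frob_fun pp p0).

Lemma frob_is_monoid_morphism : monoid_morphism frob.
Proof. by split=> [|a b]; rewrite /frob_fun ?expr1n ?exprMn. Qed.

Lemma frobD a b : frob (a + b) = frob a + frob b.
Proof. by rewrite /frob_fun (wittSE pp) -mulr_natl p0 mul0r addr0. Qed.

Lemma frob_is_zmod_morphism : zmod_morphism frob.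
Proof. by move=> a b; apply: (addIr (frob b)); rewrite -frobD !subrK. Qed.

HB.instance Definition _ := GRing.isZmodMorphism.Build _ _ frob
  frob_is_zmod_morphism.
HB.instance Definition _ := GRing.isMonoidMorphism.Build _ _ frob
  frob_is_monoid_morphism.
End FrobeniusRing.

Section Frobenius.
Variables (p : nat) (k : fieldType) (pk : p \in [pchar k]) (X : schemeOver k).

Lemma prime_of_pchar : prime p. Proof. by have /andP[] := pk. Qed.

Lemma schemeOver_pchar (U : opens X) : p%:R = 0 :> sec X U.
Proof.
have hU : U `<=` opens_preim (base_cont (str X)) (opensT (Spec k)) by [].
rewrite -(rmorph_nat (res hU)) -(rmorph_nat (comap (str X) (opensT (Spec k)))).
rewrite -(rmorph_nat (@spec_const k (opensT (Spec k)) : {rmorphism _ -> sec (Spec k) _})).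
by rewrite (pcharf0 pk) !rmorph0.
Qed.

Lemma frobenius_cont : continuous (idfun : X -> X).
Proof. by move=> x. Qed.

Lemma frobenius_sub (U : opens X) : opens_preim frobenius_cont U `<=` U.
Proof. by []. Qed.

Definition frobenius_comap (U : opens X) :
    {rmorphism sec X U -> sec X (opens_preim frobenius_cont U)} :=
  res (@frobenius_sub U) \o frob_fun prime_of_pchar (schemeOver_pchar U).

Lemma frobenius_comap_res (U V : opens X) (h : V `<=` U) s :
  frobenius_comap V (res h s) = res (opens_preim_sub frobenius_cont h) (frobenius_comap U s).
Proof.
rewrite /frobenius_comap /= /frob_fun -rmorphXn.
have k' : opens_preim frobenius_cont V `<=` U by [].
by rewrite (res_comp _ _ k') (res_comp _ _ k').
Qed.

Definition frobenius_rsmap : rsmorphism X X := RSMorphism frobenius_comap_res.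

Lemma frobenius_local x : local_hom (stalk_map frobenius_rsmap x).
Proof.
move=> a; have [U [Ux [s ->]]] := germ_surj a.
rewrite (stalk_map_germ frobenius_rsmap Ux) /= /frobenius_comap /= /frob_fun.
rewrite (germ_res Ux) rmorphXn.
case: p prime_of_pchar => // n _; rewrite exprS.
by rewrite invertibleM => -[].
Qed.

Definition frobenius : morphism X X := Morphism frobenius_local.
End Frobenius.

Definition perfect (p : nat) (k : fieldType) : Prop :=
  forall x : k, exists y : k, y ^+ p = x.

(* Since W_2(k) -> k is the quotient by (p), the base change of the total space
   to k is the closed subscheme cut out by the ideal sheaf generated by p: it
   has the same underlying space, and its structure sheaf is the quotient of
   that of the total space by this ideal. The last four fields say that [red]
   identifies X with this closed subscheme. *)
Record lifting (p : nat) (pp : prime p) (k : fieldType) (X : schemeOver k) := Lifting {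
  total :> schemeOver (witt2 pp k);
  total_flat : flat (str total);
  red : morphism X total;
  red_over : mcomp (str total) red = mcomp (Spec_map (@w0 p pp k)) (str X);
  red_bij : bijective red;
  red_open : forall U : opens X, open (red @` U);
  red_surj : forall (x : X) (b : stalk x), exists a, stalk_map red x a = b;
  red_ker : forall (x : X) (a : stalk (red x)),
    stalk_map red x a = 0 <-> exists b, a = b *+ p
}.
Arguments red {p pp k X} Xt : rename.

Definition lifts (p : nat) (pp : prime p) (k : fieldType) (X Y : schemeOver k)
    (Xt : lifting pp X) (Yt : lifting pp Y) (f : morphism X Y)
    (ft : morphism Xt Yt) : Prop :=
  mcomp ft (red Xt) = mcomp (red Yt) f.
Arguments lifts {p pp k X Y} Xt Yt f ft.

Section W2.
Variables (p : nat) (pp : prime p) (X : ringedSpace).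

Definition W2_sec (U : opens X) : comPzRingType := witt2 pp (sec X U).

Definition W2_res (U V : opens X) (h : V `<=` U) : {rmorphism W2_sec U -> W2_sec V} :=
  witt2_map pp (res h).

Lemma W2_res_id (U : opens X) (h : U `<=` U) (s : W2_sec U) : W2_res h s = s.
Proof. by apply: witt2P; exact: res_id. Qed.

Lemma W2_res_comp (U V W : opens X) (hVU : V `<=` U) (hWV : W `<=` V)
  (hWU : W `<=` U) (s : W2_sec U) : W2_res hWV (W2_res hVU s) = W2_res hWU s.
Proof. by apply: witt2P; exact: res_comp. Qed.

Lemma W2_res_inj (U : opens X) (I : Type) (V : I -> opens X)
    (hV : forall i, V i `<=` U) : U `<=` \bigcup_i V i ->
  forall s t : W2_sec U, (forall i, W2_res (hV i) s = W2_res (hV i) t) -> s = t.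
Proof.
move=> cover s t E; apply: witt2P; apply: (res_inj (hV := hV) cover) => i.
  exact: (congr1 (@w0 _ _ _) (E i)).
exact: (congr1 (@w1 _ _ _) (E i)).
Qed.

Lemma W2_res_glue (U : opens X) (I : Type) (V : I -> opens X)
    (hV : forall i, V i `<=` U) : U `<=` \bigcup_i V i ->
  forall s : (forall i, W2_sec (V i)),
  (forall i j (W : opens X) (hi : W `<=` V i) (hj : W `<=` V j),
     W2_res hi (s i) = W2_res hj (s j)) ->
  exists t : W2_sec U, forall i, W2_res (hV i) t = s i.
Proof.
move=> cover s E.
have [|t0 T0] := @res_glue X U I V hV cover (fun i => w0 (s i)).
  by move=> i j W hi hj; exact: (congr1 (@w0 _ _ _) (E i j W hi hj)).
have [|t1 T1] := @res_glue X U I V hV cover (fun i => w1 (s i)).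
  by move=> i j W hi hj; exact: (congr1 (@w1 _ _ _) (E i j W hi hj)).
by exists (Witt2 pp t0 t1) => i; apply: witt2P; [exact: T0|exact: T1].
Qed.

Definition W2 : ringedSpace :=
  @RingedSpace X W2_sec W2_res W2_res_id W2_res_comp W2_res_inj W2_res_glue.

Lemma W2_germ_invertible (x : X) (U : opens W2) (Ux : U x) (s : sec W2 U) :
  invertible (@germ W2 x U Ux s) <->
  invertible (@germ X x U Ux (w0 (s : witt2 pp (sec X U)))) /\
  invertible (@germ X x U Ux (w0 (s : witt2 pp (sec X U)) ^+ p +
                              w1 (s : witt2 pp (sec X U)) *+ p)).
Proof.
split=> [[b]|[]].
  have [V [Vx [t ->]]] := germ_surj b.
  pose W := opensI U V; have Wx : W x by [].
  rewrite -(@germ_res W2 x U W Ux Wx (@opensIl _ U V)).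
  rewrite -(@germ_res W2 x V W Vx Wx (@opensIr _ U V)).
  rewrite -rmorphM -(rmorph1 (@germ W2 x W Wx)) => /germ_eqP[W' [h [h' [W'x e]]]].
  have : invertible (W2_res h (W2_res (@opensIl _ U V) s)).
    exists (W2_res h (W2_res (@opensIr _ U V) t)).
    by rewrite -[RHS](rmorph1 (W2_res h')) -e -[LHS](rmorphM (W2_res h)).
  rewrite (W2_res_comp _ _ (subset_trans h (@opensIl _ U V))).
  move=> /witt2_invertible /=; set l := subset_trans _ _.
  rewrite -rmorphXn -rmorphMn -rmorphD -!(@germ_res X x U W' Ux W'x l).
  by move=> [[c ac] [d bd]]; split; [exists (@germ X x W' W'x c)|exists (@germ X x W' W'x d)];
    rewrite -rmorphM ?ac ?bd rmorph1.
move=> [b]; have [V [Vx [t ->]]] := @germ_surj X x b.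
move=> E [b']; have [V' [V'x [t' ->]]] := @germ_surj X x b'.
move=> E'.
have inv (W : opens X) (Wx : W x) (r : sec X W) (W1 : opens X) (W1x : W1 x) (r' : sec X W1) :
    germ Wx r * germ W1x r' = 1 ->
    exists (N : opens X) (h : N `<=` W), N x /\ invertible (res h r).
  pose M := opensI W W1; have Mx : M x by [].
  rewrite -(germ_res Wx Mx (@opensIl _ W W1)) -(germ_res W1x Mx (@opensIr _ W W1)).
  rewrite -rmorphM -(rmorph1 (germ Mx)) => /germ_eqP[N [h [h' [Nx e]]]].
  exists N, (subset_trans h (@opensIl _ W W1)); split=> //.
  exists (res h (res (@opensIr _ W W1) r')).
  rewrite -(rmorph1 (res h')) -e rmorphM; congr (_ * _).
  by rewrite (res_comp _ _ (subset_trans h (@opensIl _ W W1))).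
have [N [h [Nx [c C]]]] := inv _ _ _ _ _ _ E.
have [N' [h' [N'x [c' C']]]] := inv _ _ _ _ _ _ E'.
pose M := opensI N N'; have Mx : M x by [].
pose l : M `<=` U := subset_trans (@opensIl _ N N') h.
have [y Y] : invertible (W2_res l s).
  apply/witt2_invertible; split=> /=.
    exists (res (@opensIl _ N N') c).
    by rewrite -(res_comp h (@opensIl _ N N')) -rmorphM C rmorph1.
  exists (res (@opensIr _ N N') c').
  rewrite -rmorphXn -rmorphMn -rmorphD.
  by rewrite -(res_comp h' (@opensIr _ N N')) -rmorphM C' rmorph1.
exists (@germ W2 x M Mx y).
rewrite -(@germ_res W2 x U M Ux Mx l) -rmorphM.
by rewrite -(rmorph1 (@germ W2 x M Mx)) -[in RHS]Y.
Qed.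

End W2.

Section W2Map.
Variables (p : nat) (pp : prime p) (X Y : ringedSpace) (f : morphism X Y).

Definition W2_comap (V : opens (W2 pp Y)) :
    {rmorphism sec (W2 pp Y) V -> sec (W2 pp X) (opens_preim (base_cont f) V)} :=
  witt2_map pp (comap f V).

Lemma W2_comap_res (U V : opens (W2 pp Y)) (h : V `<=` U) (s : sec (W2 pp Y) U) :
  W2_comap V (res h s) =
  @res (W2 pp X) _ _ (opens_preim_sub (base_cont f) h) (W2_comap U s).
Proof. by apply: witt2P; exact: comap_res. Qed.

Definition W2_rsmap : rsmorphism (W2 pp X) (W2 pp Y) :=
  @RSMorphism (W2 pp X) (W2 pp Y) f (base_cont f) W2_comap W2_comap_res.

Lemma W2_local x : local_hom (stalk_map W2_rsmap x).
Proof.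
move=> a; have [V [Vx [s ->]]] := germ_surj a.
rewrite (stalk_map_germ W2_rsmap Vx) => /W2_germ_invertible /=.
rewrite -rmorphXn -rmorphMn -rmorphD -!(stalk_map_germ f).
by move=> [/stalk_local i0 /stalk_local i1]; apply/W2_germ_invertible.
Qed.

Definition W2_map : morphism (W2 pp X) (W2 pp Y) := Morphism W2_local.
End W2Map.

Section ThetaNu.
Variables (p : nat) (pp : prime p) (X Xt : ringedSpace) (i : morphism X Xt).

(* Liftings of f0 and f1 exist only locally, whence the open subset V. *)
Definition is_theta (th : morphism Xt (W2 pp X)) : Prop :=
  (forall x : X, th (i x) = x) /\
  forall (U : opens X) (f : witt2 pp (sec X U)) (V : opens Xt)
    (hV : V `<=` opens_preim (base_cont th) U) (hV' : opens_preim (base_cont i) V `<=` U)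
    (f0 f1 : sec Xt V),
    comap i V f0 = res hV' (w0 f) -> comap i V f1 = res hV' (w1 f) ->
    res hV (comap th U f) = f0 ^+ p + f1 *+ p.

Variable F : morphism Xt Xt.

(* F^*(f) = f^p + p * d, where p * d is computed with local liftings g of d. *)
Definition is_delta (V : opens Xt) (f : sec Xt V)
    (d : sec X (opens_preim (base_cont i) V)) : Prop :=
  forall (W : opens Xt) (hV : W `<=` V) (hF : W `<=` opens_preim (base_cont F) V)
    (g : sec Xt W), comap i W g = res (opens_preim_sub (base_cont i) hV) d ->
    res hF (comap F V f) = res hV f ^+ p + g *+ p.

Definition is_nu (n : morphism (W2 pp X) Xt) : Prop :=
  (forall x : X, n x = i x) /\
  forall (V : opens Xt) (f : sec Xt V)
    (h : opens_preim (base_cont n) V `<=` opens_preim (base_cont i) V),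
    exists2 d, unique (is_delta f) d &
      comap n V f = Witt2 pp (@res X _ (opens_preim (base_cont n) V) h (comap i V f))
                             (@res X _ (opens_preim (base_cont n) V) h d).

End ThetaNu.
Arguments is_theta {p} pp {X Xt} i th.
Arguments is_nu {p} pp {X Xt} i F n.

(* Main.v *)
Require Import Defs.
From HB Require Import structures.
From mathcomp Require Import all_boot all_order all_algebra.
From mathcomp Require Import boolp classical_sets topology.
From mathcomp Require Import ring.

(** Everything is checked on stalks. A lifting embeds X in Xt by a
    homeomorphism i which, on the stalk at each point, is a surjection A -> B of
    rings with kernel pA, where p^2 = 0 in A ([p_thickening]).

    For such a surjection, the p-th power of a lift of b : B, and p times a lift
    of b, depend on b only. Hence theta(b0, b1) = a0^p + p a1, with a0 and a1
    any lifts of b0 and b1, is a well-defined map W_2(B) -> A; it is a ring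
    morphism because the formulas for the addition and the multiplication of
    Witt vectors are the ones that make it so ([theta_fun]). These stalk maps
    glue to the morphism theta : Xt -> W_2(X), which is natural in (X, Xt)
    ([theta_natural]).

    Flatness over W_2(k), k being perfect, adds that the annihilator of p in A
    is pA ([lifting_ann]). So theta is injective in its second argument: if F
    lifts the Frobenius and f is a function on Xt, then (f mod p, delta f) is the
    only Witt vector w whose first component is f mod p and with
    theta(w) = F^*(f) ([nu_spec]). Taking this as the definition of nu^*(f), that
    nu^* is a ring morphism follows from uniqueness, and nu o theta = F
    ([nu_theta]) is its very definition.

    The proposition then becomes a chase of diagrams. Write
    psi = nu o W_2(phi) o theta_Z. If phit lifts phi, naturality gives
    psi = nu o theta_Y o phit = F_Y o phit. As theta(w) reduces to w0^p, psi
    lifts Frob_Y o phi ([psi_red]), and naturality of theta for psi, together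
    with Frob_Y o phi = phi o Frob_Z and naturality for F_Z, gives
    F_Y o psi = nu o theta_Y o psi = nu o W_2(phi) o W_2(Frob_Z) o theta_Z
    = psi o F_Z. *)

Set Implicit Arguments.
Unset Strict Implicit.
Unset Printing Implicit Defensive.

Import GRing.Theory.
Local Open Scope classical_set_scope.
Local Open Scope ring_scope.

(** * The ring morphism theta *)

Section RingTheta.
Variables (p : nat) (pp : prime p).

Record mod_p_quotient (A B : comPzRingType) (f : A -> B) : Prop := ModPQuotient {
  mod_p_surj : forall b, exists a, f a = b;
  mod_p_ker : forall a, f a = 0 <-> exists b, a = b *+ p;
  mod_p_sq0 : forall a : A, a *+ p *+ p = 0 }.

Section Quotient.
Variables (A B : comPzRingType) (f : {rmorphism A -> B}) (H : mod_p_quotient f).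

Lemma mod_p_char (b : B) : b *+ p = 0.
Proof.
have [a <-] := mod_p_surj H b.
by rewrite -rmorphMn; apply/(mod_p_ker H); exists a.
Qed.

Lemma mod_p_mulrn (a a' : A) : f a = f a' -> a *+ p = a' *+ p.
Proof.
move=> /eqP; rewrite -subr_eq0 -rmorphB => /eqP/(mod_p_ker H)[b E].
by apply/eqP; rewrite -subr_eq0 -mulrnBl E (mod_p_sq0 H).
Qed.

(** In a^p - a'^p = (a - a') * (sum of p terms), the first factor is a multiple
    of p, and so is the second, whose terms agree modulo p; and p^2 = 0. *)
Lemma mod_p_exp (a a' : A) : f a = f a' -> a ^+ p = a' ^+ p.
Proof.
move=> E; apply/eqP; rewrite -subr_eq0 subrXX.
have /(mod_p_ker H)[b ->] : f (a - a') = 0 by rewrite rmorphB E subrr.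
have /(mod_p_ker H)[c ->] : f (\sum_(j < p) a ^+ (p.-1 - j) * a' ^+ j) = 0.
  rewrite rmorph_sum (eq_bigr (fun=> f a' ^+ p.-1)) => [|j _].
    by rewrite sumr_const card_ord mod_p_char.
  rewrite rmorphM !rmorphXn E -exprD subnK //.
  by have := ltn_ord j; case: (p) j => [[]|n j /=]//; rewrite ltnS.
by rewrite mulrnAr mulrnAl (mod_p_sq0 H).
Qed.

Definition theta_fun (w : witt2 pp B) : A :=
  sval (cid (mod_p_surj H (w0 w))) ^+ p + sval (cid (mod_p_surj H (w1 w))) *+ p.

(** The arbitrary lifts chosen by [theta_fun] may be replaced with any others. *)
Lemma theta_funE (w : witt2 pp B) a0 a1 :
  f a0 = w0 w -> f a1 = w1 w -> theta_fun w = a0 ^+ p + a1 *+ p.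
Proof.
rewrite /theta_fun; case: cid => b0 /= <-; case: cid => b1 /= <- E0 E1.
by rewrite (mod_p_exp E0) (mod_p_mulrn E1).
Qed.

Lemma witt_lift (w : witt2 pp B) : exists a0 a1, f a0 = w0 w /\ f a1 = w1 w.
Proof.
have [a0 E0] := mod_p_surj H (w0 w); have [a1 E1] := mod_p_surj H (w1 w).
by exists a0, a1.
Qed.

Lemma theta_funD (v w : witt2 pp B) :
  theta_fun (v + w) = theta_fun v + theta_fun w.
Proof.
have [a0 [a1 [E0 E1]]] := witt_lift v; have [b0 [b1 [F0 F1]]] := witt_lift w.
rewrite (theta_funE E0 E1) (theta_funE F0 F1).
rewrite (@theta_funE _ (a0 + b0) (a1 + b1 - wittS p a0 b0)).
- by rewrite (wittSE pp) mulrnBl mulrnDl; ring.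
- by rewrite rmorphD E0 F0.
- by rewrite rmorphB rmorphD rmorph_wittS E0 F0 E1 F1.
Qed.

Lemma theta_fun_is_zmod_morphism : zmod_morphism theta_fun.
Proof. by move=> v w; apply: (addIr (theta_fun w)); rewrite -theta_funD !subrK. Qed.

Lemma theta_fun_is_monoid_morphism : monoid_morphism theta_fun.
Proof.
split=> [|v w].
  by rewrite (@theta_funE 1 1 0) ?rmorph1 ?rmorph0 // expr1n mul0rn addr0.
have [a0 [a1 [E0 E1]]] := witt_lift v; have [b0 [b1 [F0 F1]]] := witt_lift w.
rewrite (theta_funE E0 E1) (theta_funE F0 F1).
rewrite (@theta_funE _ (a0 * b0) (a0 ^+ p * b1 + b0 ^+ p * a1)).
- have [P N] := mulrn_ex p A.
  have := mod_p_sq0 H (a1 * b1); rewrite exprMn !N => Z.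
  transitivity (a0 ^+ p * b0 ^+ p + P * (a0 ^+ p * b1 + b0 ^+ p * a1) + P * (P * (a1 * b1))).
    by rewrite Z addr0.
  by ring.
- by rewrite rmorphM E0 F0.
- by rewrite /= mod_p_char addr0 rmorphD !rmorphM !rmorphXn E0 F0 E1 F1.
Qed.

HB.instance Definition _ := GRing.isZmodMorphism.Build _ _ theta_fun
  theta_fun_is_zmod_morphism.
HB.instance Definition _ := GRing.isMonoidMorphism.Build _ _ theta_fun
  theta_fun_is_monoid_morphism.

(** The composite W_2(B) -> A -> B is the Frobenius after the first component. *)
Lemma theta_fun_red (w : witt2 pp B) : f (theta_fun w) = w0 w ^+ p.
Proof.
have [a0 [a1 [E0 E1]]] := witt_lift w; rewrite (theta_funE E0 E1).
by rewrite rmorphD rmorphXn rmorphMn mod_p_char addr0 E0.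
Qed.

End Quotient.
End RingTheta.

(** * Multiplication by p on W_2(k) and its spectrum *)

Section WittP.
Variables (p : nat) (pp : prime p).

Definition ghost (R : comPzRingType) (w : witt2 pp R) : R := w0 w ^+ p + w1 w *+ p.

(** Adding 1 to w adds 1 to its ghost component: the Witt vector sum subtracts
    wittS(w0, 1), which is the excess of (w0 + 1)^p over w0^p + 1, divided by p. *)
Lemma ghost_natr (R : comPzRingType) n : ghost (n%:R : witt2 pp R) = n%:R.
Proof.
elim: n => [|n IH]; first by rewrite /ghost /= expr0n gtn_eqF ?prime_gt0 // mul0rn addr0.
rewrite -!natr1 -{}IH /ghost; set m := n%:R : witt2 pp R.
rewrite -[w0 (m + 1)]/(w0 m + 1) -[w1 (m + 1)]/(w1 m + 0 - wittS p (w0 m) 1).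
by rewrite (wittSE pp) expr1n addr0 mulrnBl; ring.
Qed.

(** Over the integers, the ghost components of p are both p, whence
    p = (p, 1 - p^(p-1)); the image of this vector in W_2(R) is (0, 1). *)
Lemma witt_p (R : comPzRingType) : p%:R = 0 :> R -> p%:R = Witt2 pp 0 1 :> witt2 pp R.
Proof.
move=> p0; have W0 (S : comPzRingType) : w0 (p%:R : witt2 pp S) = p%:R by rewrite rmorph_nat.
apply: witt2P; first by rewrite W0.
have [n pE] : exists n, p = n.+2 by case: (p) pp => [|[|n]] // _; exists n.
have E : w1 (p%:R : witt2 pp int) = 1 - p%:R ^+ p.-1.
  have pn0 : p%:R != 0 :> int by rewrite Num.Theory.pnatr_eq0 -lt0n prime_gt0.
  have := ghost_natr int p; rewrite /ghost W0 => e.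
  apply: (mulfI pn0); apply: (addrI (p%:R ^+ p)).
  by rewrite mulr_natl e mulrBr mulr1 -exprS prednK ?prime_gt0 //; ring.
rewrite -(rmorph_nat (witt2_map pp (intr : {rmorphism int -> R}))) /= E.
by rewrite rmorphB rmorph1 rmorphXn rmorph_nat p0 pE expr0n subr0.
Qed.

Lemma witt_mulrp (R : comPzRingType) (p0 : p%:R = 0 :> R) (w : witt2 pp R) :
  w *+ p = Witt2 pp 0 (w0 w ^+ p).
Proof.
rewrite -mulr_natl (witt_p p0); apply: witt2P; rewrite /= ?mul0r //.
by rewrite expr0n gtn_eqF ?prime_gt0 // mul0r add0r mulr1 mul1r -mulr_natl p0 mul0r addr0.
Qed.

End WittP.

Lemma frac_mulrn (A : comPzRingType) (P : primeSpec A) a s (ns : ~ P s) n :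
  Defs.frac P a s ns *+ n = Defs.frac P (a *+ n) s ns.
Proof.
elim: n => [|n IH]; first by rewrite !mulr0n frac0.
by rewrite !mulrS IH fracD; apply: frac_eq; ring.
Qed.

Lemma spec_sec_mulrn (A : comPzRingType) (U : opens (Spec A)) (s : specSec U)
  (P : primeSpec A) (UP : U P) n : (s *+ n : specSec U) P UP = s P UP *+ n.
Proof.
elim: n => [|n IH]; first by rewrite !mulr0n /= frac0.
by rewrite !mulrS -IH.
Qed.

Section SpecWitt.
Variables (p : nat) (pp : prime p) (k : fieldType) (pk : p \in [pchar k]).
Hypothesis perf : perfect p k.

(** As k is perfect, an element of W_2(k) with zero first component is a multiple
    of p. An element v outside of P has w0 v <> 0: otherwise v^2 = 0 lies in P. *)
Lemma frac_p (P : primeSpec (witt2 pp k)) a s (ns : ~ P s) :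
  Defs.frac P a s ns *+ p = 0 -> exists b, a = b *+ p.
Proof.
have p0 := pcharf0 pk.
rewrite frac_mulrn -(frac0 ns) => /frac_eqP[u nu].
rewrite mul0r mulr0 mulrnAl mulrnAr (witt_mulrp p0) => /(congr1 (@w1 _ _ _)) /= /eqP.
rewrite expf_eq0 !mulf_eq0 => /andP[_].
have unitP v : ~ P v -> w0 v != 0.
  move=> nv; apply/eqP => v0.
  suff : P (v * v) by case/primeM.
  have -> : v * v = 0; last exact: prime0.
  apply: witt2P; rewrite /= v0 ?mul0r // expr0n gtn_eqF ?prime_gt0 // !mul0r addr0 add0r.
  by rewrite -mulr_natl p0 mul0r.
rewrite (negPf (unitP u nu)) (negPf (unitP s ns)) orbF /= => /eqP a0.
have [y yp] := perf (w1 a); exists (Witt2 pp y 0).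
by rewrite (witt_mulrp p0) /= yp; apply: witt2P.
Qed.

(** The annihilator of p in the local ring of Spec W_2(k) is generated by p. *)
Lemma stalk_spec_p (P : Spec (witt2 pp k)) (a : stalk P) : a *+ p = 0 -> exists b, a = b *+ p.
Proof.
have [U [UP [s ->]]] := germ_surj a.
rewrite -rmorphMn -(rmorph0 (germ UP)) => /germ_eqP[W [h [h' [WP E]]]].
have sp : (s : specSec U) P UP *+ p = 0.
  move: (congr1 (fun r : specSec W => r P WP) E) => /=.
  by rewrite (Prop_irrelevance (h P WP) UP) spec_sec_mulrn frac0.
have [V [VP VU [c [f F]]]] := spec_valP (s : specSec U) UP.
have [nf e] := F P UP VP; move: sp; rewrite e => /frac_p[b cb].
pose N : opens (Spec (witt2 pp k)) := opensI V (basicOpen f).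
have NP : N P by [].
have tP : @locally_fraction _ N (fun Q NQ => Defs.frac Q b f (proj2 NQ)).
  by move=> Q NQ; exists N; split=> //; exists b, f => Q' NQ' _; exists (proj2 NQ').
pose t : sec (Spec (witt2 pp k)) N := SpecSec tP.
have NU : N `<=` U by move=> Q [/VU].
exists (germ NP t); rewrite -(germ_res UP NP NU) -rmorphMn; congr germ.
apply: specSecP => Q NQ.
rewrite /= spec_sec_mulrn /=; have [nf' ->] := F Q (NU Q NQ) (proj1 NQ).
by rewrite frac_mulrn cb; apply: frac_eq; ring.
Qed.

End SpecWitt.

(** * Flatness and the annihilator of p *)

Section Flat.
Variables (R : comPzRingType) (p : nat).

(** Stated on [R^o], so that the ideal pR inherits a module structure over R. *)
Definition p_multiple : pred R^o := fun r => `[< exists b, r = b *+ p >].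

Lemma p_multiple_submod : submod_closed p_multiple.
Proof.
split=> [|r u v]; rewrite !unfold_in.
  by apply/asboolP; exists 0; rewrite mul0rn.
move=> /asboolP[b ->] /asboolP[c ->]; apply/asboolP; exists (r * b + c).
by rewrite -scalerMnr -mulrnDl.
Qed.
HB.instance Definition _ := GRing.isSubmodClosed.Build R R^o p_multiple p_multiple_submod.

Record p_ideal := PIdeal { p_ideal_val :> R^o; _ : p_ideal_val \in p_multiple }.
HB.instance Definition _ := [isSub for p_ideal_val].
HB.instance Definition _ := [Choice of p_ideal by <:].
HB.instance Definition _ := [SubChoice_isSubLmodule of p_ideal by <:].

Lemma p_idealP (u : p_ideal) : exists b : R, p_ideal_val u = b *+ p.
Proof. by case: u => u /= /asboolP. Qed.

Hypothesis annR : forall a : R, a *+ p = 0 -> exists b, a = b *+ p.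
Variables (A B : comPzRingType) (f : {rmorphism R -> A}) (g : {rmorphism A -> B}).
Hypothesis p0 : p%:R = 0 :> B.

(** The criterion of flatness for the inclusion of pR in R. If p a = 0, then
    p (x) a vanishes in R (x) A, hence in pR (x) A. Since Ann(p) = pR and p = 0 in
    B, the map (p b, t) |-> g (f b) g t on pR x A is well defined, and it sends
    p (x) a to g a. *)
Lemma flat_p (a : A) : flat_hom f -> a *+ p = 0 -> g a = 0.
Proof.
move=> flf ap.
pose q (u : p_ideal) : R := sval (cid (p_idealP u)).
have qE u : p_ideal_val u = q u *+ p by rewrite /q; case: cid.
have gq b c : b *+ p = c *+ p -> g (f b) = g (f c).
  move=> /eqP; rewrite -subr_eq0 -mulrnBl => /eqP/annR[d E].
  by apply/eqP; rewrite -subr_eq0 -!rmorphB E !rmorphMn -mulr_natl p0 mul0r.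
pose bil (u : p_ideal) (t : A) : B := g (f (q u)) * g t.
have pin : (p%:R : R^o) \in p_multiple by rewrite unfold_in; apply/asboolP; exists 1.
(* p itself, as an element of the ideal pR *)
pose P1 : p_ideal := PIdeal pin.
have := flf p_ideal R^o (val : {linear p_ideal -> R^o}) val_inj 1%N (fun=> P1) (fun=> a).
move=> /(_ _ B bil); rewrite big_ord1 /bil.
have -> : g (f (q P1)) = 1.
  by rewrite (gq _ 1) ?rmorph1 // -qE.
rewrite mul1r; apply.
- move=> T C CD CD' CZ; rewrite big_ord1.
  rewrite -[LHS]/(C (p%:R : R^o) a) -[X in C X a]mulr1.
  rewrite -[X in C X a]/((p%:R : R) *: (1 : R^o)) CZ rmorph_nat mulr_natl ap.
  by apply: (addrI (C 1 0)); rewrite -CD' !addr0.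
- move=> u v t; rewrite -mulrDl -!rmorphD; congr (_ * _); apply: gq.
  by rewrite -qE mulrnDl -!qE.
- by move=> u t t'; rewrite rmorphD mulrDr.
- move=> r u t; rewrite rmorphM mulrA; congr (_ * _); rewrite mulrC -!rmorphM.
  by apply: gq; rewrite -mulrnAr -!qE.
Qed.
End Flat.

(** * Sections and germs *)

Section Glue.
Variables (X : ringedSpace) (T : Type) (q : T -> X).
Hypothesis q_surj : forall y, exists x, q x = y.

Lemma germ_inj_along (U : opens X) (s t : sec X U) :
  (forall x (Ux : U (q x)), germ Ux s = germ Ux t) -> s = t.
Proof.
by move=> E; apply: sec_germ_inj => y; have [x <-] := q_surj y; exact: E.
Qed.

(** A section may be prescribed by its germs, provided that locally some section
    has them. Points are indexed along a surjection q, so that in the case of a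
    thickening i every germ is taken at a point i x and none has to be
    transported along an equality of points. *)
Lemma glue_germs (U : opens X) (G : forall x, stalk (q x) -> Prop) :
  (forall x a b, U (q x) -> G x a -> G x b -> a = b) ->
  (forall x, U (q x) -> exists (V : opens X) (t : sec X V),
     [/\ V (q x), V `<=` U & forall x' (h : V (q x')), G x' (germ h t)]) ->
  exists t : sec X U, forall x (h : U (q x)), G x (germ h t).
Proof.
move=> Gu Gex.
have /choice[V VP] : forall y : {x | U (q x)}, exists V : opens X,
    exists t : sec X V, [/\ V (q (sval y)), V `<=` U &
      forall x' (h : V (q x')), G x' (germ h t)].
  by case=> x Ux; exact: Gex.
pose t y := sval (cid (VP y)).
have tP y : [/\ V y (q (sval y)), V y `<=` U &
      forall x' (h : V y (q x')), G x' (germ h (t y))].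
  by rewrite /t; case: cid.
have hV y : V y `<=` U by case: (tP y).
have cover : U `<=` \bigcup_y V y.
  move=> z; have [x <-] := q_surj z => Ux.
  by exists (exist _ x Ux) => //; case: (tP (exist _ x Ux)).
have [|s sE] := @res_glue X U _ V hV cover t.
  move=> y y' W hy hy'; apply: germ_inj_along => x Wx.
  rewrite (germ_res (hy _ Wx)) (germ_res (hy' _ Wx)).
  have [_ _ E] := tP y; have [_ _ E'] := tP y'.
  by apply: Gu (E _ _) (E' _ _); exact: hV (hy _ Wx).
exists s => x Ux; have [Vx _ E] := tP (exist _ x Ux); move: Vx => /= Vx.
by rewrite -(germ_res Ux Vx (hV _)) sE; exact: E.
Qed.
End Glue.

(** The domain of [comap (mcomp g f) V s] and that of the iterated pullback are the
    same set, but with distinct proofs of openness: [comap] of a composite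
    inserts a restriction, which germs ignore. *)
Lemma germ_mcomp (X Y Z : ringedSpace) (g : morphism Y Z) (f : morphism X Y)
    (V : opens Z) (s : sec Z V) x (h : V (g (f x))) :
  @germ X x (opens_preim (base_cont (mcomp g f)) V) h (comap (mcomp g f) V s) =
  @germ X x (opens_preim (base_cont f) (opens_preim (base_cont g) V)) h
    (comap f _ (comap g V s)).
Proof. exact: germ_res. Qed.

Lemma morphism_germ (X Y : ringedSpace) (f g : morphism X Y) (V : opens Y)
    (s : sec Y V) x (fx : V (f x)) (gx : V (g x)) : f = g ->
  @germ X x (opens_preim (base_cont f) V) fx (comap f V s) =
  @germ X x (opens_preim (base_cont g) V) gx (comap g V s).
Proof. by move=> E; subst g; rewrite (Prop_irrelevance gx fx). Qed.

Record p_thickening (p : nat) (X Xt : ringedSpace) (i : morphism X Xt) : Prop := PThickening {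
  pt_inj : injective i;
  pt_surj : forall y, exists x, i x = y;
  pt_open : forall U : opens X, open (i @` U);
  pt_stalk : forall x, mod_p_quotient p (stalk_map i x)
}.

(** * The morphism theta of a thickening *)

Section Theta.
Variables (p : nat) (pp : prime p) (X Xt : ringedSpace) (i : morphism X Xt).
Hypothesis H : p_thickening p i.

Definition pt_image (U : opens X) : opens Xt := Opens (i @` U) (pt_open H U).

Lemma pt_imageP (U : opens X) x : pt_image U (i x) <-> U x.
Proof. by split=> [[y Uy /(pt_inj H) <-]|Ux] //; exists x. Qed.

(** By surjectivity on stalks, some section of Xt reduces to a section with the
    germ of s at x. The reduction agrees with s on a neighbourhood W of x, and
    i(W) is open in Xt. *)
Lemma local_lift (U : opens X) (s : sec X U) x (Ux : U x) :
  exists (V : opens Xt) (f : sec Xt V) (h : opens_preim (base_cont i) V `<=` U),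
    V (i x) /\ comap i V f = res h s.
Proof.
have [a ax] := mod_p_surj (pt_stalk H x) (germ Ux s).
have [V [Vx [f aE]]] := germ_surj a; subst a.
move: ax; rewrite stalk_map_germ => /germ_eqP[W [hV [hU [Wx E]]]].
have WV : opensI V (pt_image W) `<=` V by apply: subIsetl.
have h : opens_preim (base_cont i) (opensI V (pt_image W)) `<=` W.
  by move=> y [_ /pt_imageP].
exists (opensI V (pt_image W)), (res WV f), (subset_trans h hU).
split; first by split=> //; apply/pt_imageP.
by rewrite comap_res -(res_comp hU h) -E (res_comp hV h (opens_preim_sub _ WV)).
Qed.

Definition witt_germ (U : opens X) x (Ux : U x) :
  {rmorphism witt2 pp (sec X U) -> witt2 pp (stalk x)} :=
  witt2_map pp (germ Ux).

Definition stalk_theta x : {rmorphism witt2 pp (stalk x) -> stalk (i x)} :=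
  theta_fun (pt_stalk H x).

Lemma witt_germ_res (U V : opens X) x (Ux : U x) (Vx : V x) (h : V `<=` U) w :
  witt_germ Vx (witt2_map pp (res h) w) = witt_germ Ux w.
Proof. by apply: witt2P; rewrite /= germ_res. Qed.

Lemma stalk_thetaE x (w : witt2 pp (stalk x)) a0 a1 :
  stalk_map i x a0 = w0 w -> stalk_map i x a1 = w1 w -> stalk_theta x w = a0 ^+ p + a1 *+ p.
Proof. exact: theta_funE. Qed.

(** The inverse of i. It takes values in [W2 pp X], whose underlying space is X,
    since it is the continuous map underlying theta. *)
Definition retract (y : Xt) : W2 pp X := sval (cid (pt_surj H y)).
Lemma retractK y : i (retract y) = y.
Proof. by rewrite /retract; case: cid. Qed.
Lemma retract_red x : retract (i x) = x.
Proof. exact: (pt_inj H (retractK _)). Qed.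

Lemma retract_cont : continuous retract.
Proof.
apply/continuousP => A oA; have := pt_open H (Opens A oA).
congr open; apply/seteqP; split=> y /=; first by move=> [x Ax <-]; rewrite retract_red.
by move=> Ay; exists (retract y) => //; exact: retractK.
Qed.

Lemma local_witt_lift (U : opens X) (w : witt2 pp (sec X U)) x (Ux : U x) :
  exists (V : opens Xt) (f0 f1 : sec Xt V) (h : opens_preim (base_cont i) V `<=` U),
    [/\ V (i x), comap i V f0 = res h (w0 w) & comap i V f1 = res h (w1 w)].
Proof.
have [V [f [h [Vx E]]]] := local_lift (w0 w) Ux.
have [V' [f' [h' [Vx' E']]]] := local_lift (w1 w) Ux.
exists (opensI V V'), (res (@opensIl _ V V') f), (res (@opensIr _ V V') f').
exists (subset_trans (opens_preim_sub _ (@opensIl _ V V')) h).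
split=> //.
  by rewrite comap_res E; exact: res_comp.
by rewrite comap_res E'; exact: res_comp.
Qed.

Lemma stalk_theta_germ (U : opens X) (w : witt2 pp (sec X U)) (V : opens Xt) (f0 f1 : sec Xt V)
  (h : opens_preim (base_cont i) V `<=` U) x (Ux : U x) (Vx : V (i x)) :
  comap i V f0 = res h (w0 w) -> comap i V f1 = res h (w1 w) ->
  stalk_theta x (witt_germ Ux w) = germ Vx (f0 ^+ p + f1 *+ p).
Proof.
move=> E0 E1; rewrite rmorphD rmorphXn rmorphMn; apply: stalk_thetaE.
  by rewrite stalk_map_germ E0 germ_res.
by rewrite stalk_map_germ E1 germ_res.
Qed.

Definition theta_preim (U : opens X) : opens Xt := opens_preim retract_cont U.
Lemma theta_preimP (U : opens X) x : theta_preim U (i x) -> U x.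
Proof. by rewrite /= retract_red. Qed.

Lemma theta_sec_ex (U : opens X) (w : witt2 pp (sec X U)) :
  exists t : sec Xt (theta_preim U), forall x (h : theta_preim U (i x)),
    germ h t = stalk_theta x (witt_germ (theta_preimP h) w).
Proof.
have [|x UU|t tP] := @glue_germs Xt X i (pt_surj H) (theta_preim U)
   (fun x a => forall Ux : U x, a = stalk_theta x (witt_germ Ux w)).
- by move=> x a b /theta_preimP Ux -> ->.
- have Ux := theta_preimP UU; have [V [f0 [f1 [h [Vx E0 E1]]]]] := local_witt_lift w Ux.
  exists V, (f0 ^+ p + f1 *+ p); split=> //.
    by move=> y Vy; apply: (h (retract y)); rewrite /= retractK.
  by move=> x' Vx' Ux'; rewrite (stalk_theta_germ Ux' Vx' E0 E1).
by exists t => x h; exact: tP.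
Qed.

Definition theta_sec (U : opens X) (w : witt2 pp (sec X U)) : sec Xt (theta_preim U) :=
  sval (cid (theta_sec_ex w)).

Lemma germ_theta_sec (U : opens X) (w : witt2 pp (sec X U)) x (h : theta_preim U (i x)) (Ux : U x) :
  germ h (theta_sec w) = stalk_theta x (witt_germ Ux w).
Proof.
by rewrite /theta_sec; case: cid => t /= ->;
  rewrite (Prop_irrelevance (theta_preimP h) Ux).
Qed.

Lemma theta_sec_is_zmod_morphism (U : opens X) : zmod_morphism (@theta_sec U).
Proof.
move=> v w; apply: (germ_inj_along (pt_surj H)) => x h; have Ux := theta_preimP h.
by rewrite rmorphB /= !(germ_theta_sec _ h Ux) !rmorphB.
Qed.

Lemma theta_sec_is_monoid_morphism (U : opens X) : monoid_morphism (@theta_sec U).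
Proof.
split=> [|v w]; apply: (germ_inj_along (pt_surj H)) => x h; have Ux := theta_preimP h.
  by rewrite (germ_theta_sec _ h Ux) !rmorph1.
by rewrite rmorphM /= !(germ_theta_sec _ h Ux) !rmorphM.
Qed.

HB.instance Definition _ (U : opens X) := GRing.isZmodMorphism.Build _ _ (@theta_sec U)
  (@theta_sec_is_zmod_morphism U).
HB.instance Definition _ (U : opens X) := GRing.isMonoidMorphism.Build _ _ (@theta_sec U)
  (@theta_sec_is_monoid_morphism U).

Definition theta_comap (U : opens (W2 pp X)) :
  {rmorphism sec (W2 pp X) U -> sec Xt (opens_preim retract_cont U)} := @theta_sec U.

Lemma theta_comap_res (U V : opens (W2 pp X)) (h : V `<=` U) s :
  theta_comap V (res h s) = res (opens_preim_sub retract_cont h) (theta_comap U s).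
Proof.
apply: (germ_inj_along (pt_surj H)) => x hV; have Vx := theta_preimP hV.
have hU : theta_preim U (i x) by exact: h.
rewrite (germ_res hU) /= (germ_theta_sec _ hU (h _ Vx)) (germ_theta_sec _ hV Vx).
by rewrite (witt_germ_res (h _ Vx)).
Qed.

Definition theta_rsmap : rsmorphism Xt (W2 pp X) := RSMorphism theta_comap_res.

(** If theta(w) is invertible, so is its reduction w0^p, hence w0; and w0^p + p w1
    equals w0^p because p = 0 on X. *)
Lemma theta_local y : local_hom (stalk_map theta_rsmap y).
Proof.
have [x ->] : exists x, y = i x by exists (retract y); rewrite retractK.
move=> a; have [U [UU [s ->]]] := @germ_surj (W2 pp X) _ a; have Ux := theta_preimP UU.
rewrite (stalk_map_germ theta_rsmap) (germ_theta_sec _ UU Ux) => -[b].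
move=> /(congr1 (stalk_map i x)); rewrite rmorphM rmorph1 theta_fun_red /= => E.
move: UU; rewrite /= retract_red => UU; rewrite (Prop_irrelevance UU Ux) {UU}.
have I : invertible (germ Ux (w0 (s : witt2 pp _)) ^+ p) by eexists; exact: E.
apply/W2_germ_invertible; split.
  by move: I; rewrite -[X in _ ^+ X](prednK (prime_gt0 pp)) exprS invertibleM => -[].
by rewrite rmorphD rmorphXn rmorphMn (mod_p_char (pt_stalk H x)) addr0.
Qed.

Definition theta_morphism : morphism Xt (W2 pp X) := Morphism theta_local.

Lemma theta_morphismP : is_theta pp i theta_morphism.
Proof.
split=> [x|U f V hV hV' f0 f1 E0 E1]; first exact: retract_red.
apply: (germ_inj_along (pt_surj H)) => x Vx; have Ux := theta_preimP (hV _ Vx).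
by rewrite (germ_res (hV _ Vx)) /= (germ_theta_sec _ _ Ux) (stalk_theta_germ Ux Vx E0 E1).
Qed.

Lemma germ_theta (th : morphism Xt (W2 pp X)) (U : opens X) (w : witt2 pp (sec X U))
  x (Ux : U x) (h : U (th (i x))) :
  is_theta pp i th ->
  @germ Xt (i x) (opens_preim (base_cont th) U) h (comap th U w) =
  stalk_theta x (witt_germ Ux w).
Proof.
move=> [thi thP]; have [V [f0 [f1 [hV [Vx E0 E1]]]]] := local_witt_lift w Ux.
have k : V `<=` opens_preim (base_cont th) U.
  move=> y; have [x' <-] := pt_surj H y => Vx'.
  have := hV _ Vx'; by rewrite -[x' in U x']thi.
rewrite (stalk_theta_germ Ux Vx E0 E1) -(thP _ _ _ k hV _ _ E0 E1).
by rewrite (@germ_res Xt (i x) (opens_preim (base_cont th) U) V h Vx k).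
Qed.

(** Local lifts exist around every point ([local_witt_lift]), so that the defining
    formula determines all germs of the pullback. *)
Lemma theta_unique th : is_theta pp i th -> theta_morphism = th.
Proof.
move=> thP; apply: morphism_eq => [y|U w y].
  by have [x <-] := pt_surj H y; rewrite (proj1 thP) /= retract_red.
have [x <-] := pt_surj H y => hx hx'; have Ux : U x by rewrite -(proj1 thP x).
by rewrite (germ_theta _ Ux hx' thP) (germ_theta _ Ux hx theta_morphismP).
Qed.

End Theta.

(** * The morphism nu of a Frobenius lifting *)

Section Nu.
Variables (p : nat) (pp : prime p) (X Xt : ringedSpace) (i : morphism X Xt).
Hypothesis H : p_thickening p i.
Hypothesis ann : forall x (a : stalk (i x)), a *+ p = 0 -> stalk_map i x a = 0.
Variable F : morphism Xt Xt.
Hypothesis Fi : forall x, F (i x) = i x.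
Hypothesis Ff : forall (V : opens Xt) (f : sec Xt V) x (h : V (i x))
  (h' : opens_preim (base_cont F) V (i x)),
  stalk_map i x (germ h' (comap F V f)) = stalk_map i x (germ h f) ^+ p.

Lemma fixed_preim (V : opens Xt) x : V (i x) -> opens_preim (base_cont F) V (i x).
Proof. by rewrite /= Fi. Qed.

(** As Ann(p) is the kernel of the reduction, p w1 determines w1. *)
Lemma stalk_theta_inj x (v w : witt2 pp (stalk x)) :
  w0 v = w0 w -> stalk_theta pp H _ v = stalk_theta pp H _ w -> v = w.
Proof.
move=> E0; have [a0 [a1 [A0 A1]]] := witt_lift (pt_stalk H x) v.
have [b0 [b1 [B0 B1]]] := witt_lift (pt_stalk H x) w.
have C0 : stalk_map i x a0 = w0 w by rewrite A0.
rewrite (stalk_thetaE H A0 A1) (stalk_thetaE H C0 B1) => /addrI/eqP.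
rewrite -subr_eq0 -mulrnBl => /eqP/ann/eqP; rewrite rmorphB subr_eq0 A1 B1 => /eqP.
exact: witt2P.
Qed.

Local Notation pre V := (opens_preim (base_cont i) V).

(** The pairs (f mod p, delta f), without the division by p: the second condition
    reads F^*(f) = f^p + p (delta f). As f |-> f mod p, F^* and theta are ring
    morphisms, both conditions are compatible with the ring operations. *)
Definition nu_spec (V : opens Xt) (f : sec Xt V) (w : witt2 pp (sec X (pre V))) : Prop :=
  w0 w = comap i V f /\
  forall x (h : V (i x)),
    stalk_theta pp H _ (witt_germ pp (h : pre V x) w) =
    germ (fixed_preim h) (comap F V f).

Lemma nu_spec_unique V f v w : @nu_spec V f v -> nu_spec f w -> v = w.
Proof.
move=> [v0 vF] [w0' wF].
suff E x (h : pre V x) : witt_germ pp h v = witt_germ pp h w.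
  by apply: witt2P; apply: sec_germ_inj => x h; [move: (congr1 (@w0 _ _ _) (E x h))
    | move: (congr1 (@w1 _ _ _) (E x h))].
by apply: stalk_theta_inj; rewrite /= ?v0 ?w0' // vF wF.
Qed.

(** F^*(f) - f^p reduces to 0, so that it is a multiple of p on each stalk. *)
Lemma frob_lift (V : opens Xt) (f : sec Xt V) x (Vx : V (i x)) :
  exists (W : opens Xt) (hV : W `<=` V) (hF : W `<=` opens_preim (base_cont F) V) (g : sec Xt W),
    W (i x) /\ res hF (comap F V f) = res hV f ^+ p + g *+ p.
Proof.
have : stalk_map i x (germ (fixed_preim Vx) (comap F V f) - germ Vx f ^+ p) = 0.
  by rewrite rmorphB rmorphXn /= (Ff f Vx) subrr.
move=> /(mod_p_ker (pt_stalk H x))[b /eqP]; rewrite subr_eq => /eqP.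
have [U [Ux [g ->]]] := germ_surj b.
pose N := opensI U (opensI V (opens_preim (base_cont F) V)).
have NU : N `<=` U by move=> y [].
have NV : N `<=` V by move=> y [_ []].
have NF : N `<=` opens_preim (base_cont F) V by move=> y [_ []].
have Nx : N (i x) by split=> //; split=> //; exact: fixed_preim.
rewrite -(germ_res Ux Nx NU) -(germ_res (fixed_preim Vx) Nx NF) -(germ_res Vx Nx NV).
rewrite -rmorphXn -rmorphMn -rmorphD => /germ_eqP[W [h [h' [Wx E]]]].
exists W, (subset_trans h NV), (subset_trans h NF), (res h (res NU g)); split=> //.
rewrite -(res_comp NF h) E (Prop_irrelevance h' h) addrC.
by rewrite rmorphD rmorphXn rmorphMn (res_comp NV h (subset_trans h NV)).
Qed.

(** Local quotients of F^*(f) - f^p by p reduce to sections of X which glue, being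
    unique. *)
Lemma nu_spec_ex (V : opens Xt) (f : sec Xt V) : exists w, nu_spec f w.
Proof.
have [|x Vx|d dP] := @glue_germs X X id (fun y => ex_intro _ y erefl) (pre V)
   (fun x a => forall h : V (i x),
     stalk_theta pp H _ (Witt2 pp (stalk_map i x (germ h f)) a) =
     germ (fixed_preim h) (comap F V f)).
- move=> x a b Vx /(_ Vx) A /(_ Vx) B.
  by apply: (congr1 (@w1 _ _ _) (stalk_theta_inj _ (etrans A (esym B)))).
- have [W [hV [hF [g [Wx E]]]]] := frob_lift f Vx.
  exists (pre W), (comap i W g); split=> // [y /hV//|y Wy' Vy].
  have Wy : W (i y) by exact: Wy'.
  rewrite -(germ_res (fixed_preim Vy) Wy hF) E.
  rewrite (stalk_thetaE H (a0 := germ Vy f) (a1 := germ Wy g)) //=.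
    by rewrite rmorphD rmorphMn rmorphXn /= (germ_res Vy).
  by rewrite stalk_map_germ (Prop_irrelevance Wy' Wy).
exists (Witt2 pp (comap i V f) d); split=> // x h; rewrite -dP /=; congr (stalk_theta pp H _ _).
by apply: witt2P; rewrite //= stalk_map_germ.
Qed.

Definition nu_sec (V : opens Xt) (f : sec Xt V) : witt2 pp (sec X (pre V)) :=
  sval (cid (nu_spec_ex f)).

Lemma nu_secP V f : nu_spec f (@nu_sec V f).
Proof. by rewrite /nu_sec; case: cid. Qed.

Lemma nu_sec_is_zmod_morphism V : zmod_morphism (@nu_sec V).
Proof.
move=> f g; apply: (nu_spec_unique (nu_secP _)).
have [f0 fF] := nu_secP f; have [g0 gF] := nu_secP g.
split=> [|x h]; rewrite !rmorphB.
  by congr (_ - _); [exact: f0|exact: g0].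
by congr (_ - _); [exact: fF|exact: gF].
Qed.

Lemma nu_sec_is_monoid_morphism V : monoid_morphism (@nu_sec V).
Proof.
split=> [|f g]; apply: (nu_spec_unique (nu_secP _)).
  by split=> [|x h]; rewrite !rmorph1.
have [f0 fF] := nu_secP f; have [g0 gF] := nu_secP g.
split=> [|x h]; rewrite !rmorphM.
  by congr (_ * _); [exact: f0|exact: g0].
by congr (_ * _); [exact: fF|exact: gF].
Qed.

HB.instance Definition _ (V : opens Xt) := GRing.isZmodMorphism.Build _ _ (@nu_sec V)
  (@nu_sec_is_zmod_morphism V).
HB.instance Definition _ (V : opens Xt) := GRing.isMonoidMorphism.Build _ _ (@nu_sec V)
  (@nu_sec_is_monoid_morphism V).

Definition nu_cont : continuous (i : W2 pp X -> Xt) := base_cont i.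

Definition nu_comap (V : opens Xt) :
  {rmorphism sec Xt V -> sec (W2 pp X) (opens_preim nu_cont V)} := @nu_sec V.

Lemma nu_comap_res (U V : opens Xt) (h : V `<=` U) s :
  nu_comap V (res h s) = res (opens_preim_sub nu_cont h) (nu_comap U s).
Proof.
apply: (nu_spec_unique (nu_secP _)).
have [s0 sF] := nu_secP s; split=> [|x Vx].
  by rewrite /= s0 comap_res.
rewrite comap_res (germ_res (fixed_preim (h _ Vx))) -sF; congr (stalk_theta pp H _ _).
exact: witt_germ_res.
Qed.

Definition nu_rsmap : rsmorphism (W2 pp X) Xt :=
  @RSMorphism (W2 pp X) Xt i nu_cont nu_comap nu_comap_res.

Lemma nu_local x : local_hom (stalk_map nu_rsmap x).
Proof.
move=> a; have [V [Vx [s ->]]] := germ_surj a.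
rewrite (stalk_map_germ nu_rsmap Vx) => /W2_germ_invertible[/=+ _].
by have [-> _] := nu_secP s; rewrite -(stalk_map_germ i Vx) => /stalk_local.
Qed.

Definition nu_morphism : morphism (W2 pp X) Xt := Morphism nu_local.

(** A local lift of d exists around every point, and theta does not depend on it:
    testing all lifts and testing the stalks amount to the same. *)
Lemma delta_specP (V : opens Xt) (f : sec Xt V) (d : sec X (pre V)) :
  is_delta p F f d <-> nu_spec f (Witt2 pp (comap i V f) d).
Proof.
split=> [D|[_ D] W hV hF g E].
  split=> // x Vx; have [U [g [h [Ux E]]]] := local_lift H d Vx.
  pose N := opensI U (opensI V (opens_preim (base_cont F) V)).
  have NU : N `<=` U by move=> y [].
  have NV : N `<=` V by move=> y [_ []].
  have NF : N `<=` opens_preim (base_cont F) V by move=> y [_ []].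
  have Nx : N (i x) by split=> //; split=> //; exact: fixed_preim.
  rewrite -(germ_res (fixed_preim Vx) Nx NF) (D N NV NF (res NU g)); last first.
    by rewrite comap_res E; apply: res_comp.
  rewrite (stalk_thetaE H (a0 := germ Vx f) (a1 := germ Ux g)) /= ?stalk_map_germ //.
    by rewrite rmorphD rmorphMn rmorphXn /= (germ_res Ux) (germ_res Vx).
  by rewrite E (germ_res (Vx : pre V x)).
apply: (germ_inj_along (pt_surj H)) => x Wx.
rewrite (germ_res (fixed_preim (hV _ Wx))) -D.
rewrite (stalk_thetaE H (a0 := germ (hV _ Wx) f) (a1 := germ Wx g)) /= ?stalk_map_germ //.
  by rewrite rmorphD rmorphMn rmorphXn /= (germ_res (hV _ Wx)).
by rewrite E (germ_res (hV _ Wx : pre V x)).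
Qed.

Lemma delta_unique (V : opens Xt) (f : sec Xt V) (d d' : sec X (pre V)) :
  is_delta p F f d -> is_delta p F f d' -> d = d'.
Proof.
by move=> /delta_specP D /delta_specP D'; move: (congr1 (@w1 _ _ _) (nu_spec_unique D D')).
Qed.

Lemma nu_delta (V : opens Xt) (f : sec Xt V) : is_delta p F f (w1 (nu_sec f)).
Proof.
apply/delta_specP; have := nu_secP f; case: (nu_sec f) => a b S.
by have := S; case: S => /= -> _.
Qed.

Lemma nu_morphismP : is_nu pp i F nu_morphism.
Proof.
split=> // V f h; exists (w1 (nu_sec f)); last first.
  by apply: witt2P; rewrite /= res_id //; case: (nu_secP f).
by split=> [|d D]; [|apply: delta_unique D]; exact: nu_delta.
Qed.

Lemma germ_nu (n : morphism (W2 pp X) Xt) (V : opens Xt) (f : sec Xt V)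
  x (Vx : V (n x)) (Vx' : pre V x) :
  is_nu pp i F n ->
  @germ (W2 pp X) x (opens_preim (base_cont n) V) Vx (comap n V f) =
  @germ (W2 pp X) x (pre V) Vx' (nu_sec f).
Proof.
move=> [ni nP].
have h : opens_preim (base_cont n) V `<=` pre V by move=> y; rewrite /= -ni.
have [d [D _] ->] := nP V f h.
rewrite -(@germ_res (W2 pp X) x (pre V) (opens_preim (base_cont n) V) Vx' Vx h).
congr germ.
apply: witt2P => /=; congr (res _ _); first by case: (nu_secP f).
exact: delta_unique D (@nu_delta V f).
Qed.

Lemma nu_unique n : is_nu pp i F n -> nu_morphism = n.
Proof.
move=> nP; apply: morphism_eq => [x|V f x Vx Vx']; first by rewrite (proj1 nP).
by rewrite (germ_nu f Vx' Vx nP).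
Qed.

(** Both sides pull f back to theta(nu^*(f)) = F^*(f). *)
Lemma nu_theta : mcomp nu_morphism (theta_morphism pp H) = F.
Proof.
apply: morphism_eq => [y|V f y].
  by have [x <-] := pt_surj H y; rewrite /= retract_red Fi.
have [x <-] := pt_surj H y => Vx Vx'; rewrite germ_mcomp.
have Ux : V (i x) by move: Vx'; rewrite Fi.
have [_ E] := nu_secP f.
rewrite (germ_theta H (nu_sec f) (Ux : pre V x) Vx (theta_morphismP pp H)) E.
by rewrite (Prop_irrelevance Vx' (fixed_preim Ux)).
Qed.

End Nu.

(** * Naturality of theta and of the Frobenius *)

Lemma mcompA (X Y Z T : ringedSpace) (h : morphism Z T) (g : morphism Y Z)
  (f : morphism X Y) : mcomp h (mcomp g f) = mcomp (mcomp h g) f.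
Proof.
apply: morphism_eq => // V s x Vx Vx'; rewrite !germ_mcomp (Prop_irrelevance Vx' Vx).
rewrite -(stalk_map_germ f (V := opens_preim (base_cont (mcomp h g)) V) Vx).
by rewrite (germ_mcomp (g := h) (f := g)) stalk_map_germ.
Qed.

Lemma W2_map_comp (p : nat) (pp : prime p) (X Y Z : ringedSpace)
  (g : morphism Y Z) (f : morphism X Y) :
  W2_map pp (mcomp g f) = mcomp (W2_map pp g) (W2_map pp f).
Proof.
apply: morphism_eq => // V s x Vx Vx'; rewrite germ_mcomp (Prop_irrelevance Vx' Vx).
pose t := comap (W2_map pp f) _ (comap (W2_map pp g) V s).
pose U := opens_preim (base_cont f) (opens_preim (base_cont g) V).
exact: (@germ_res (W2 pp X) x U (opens_preim (base_cont (mcomp g f)) V) Vx Vx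
  (@comp_preim _ _ _ g f V) t).
Qed.

Section ThetaNatural.
Variables (p : nat) (pp : prime p) (X Xt X' Xt' : ringedSpace).
Variables (i : morphism X Xt) (i' : morphism X' Xt').
Variables (H : p_thickening p i) (H' : p_thickening p i').
Variables (h : morphism Xt Xt') (h0 : morphism X X').
Hypothesis hE : mcomp h i = mcomp i' h0.

(** Lifts of w to Xt' pull back to lifts of W_2(h0)^*(w), since h lifts h0. *)
Lemma theta_natural :
  mcomp (theta_morphism pp H') h = mcomp (W2_map pp h0) (theta_morphism pp H).
Proof.
have hx x : h (i x) = i' (h0 x) by move: (congr1 (fun f : morphism X Xt' => f x) hE).
apply: morphism_eq => [y|U w y].
  by have [x <-] := pt_surj H y; rewrite /= hx !retract_red.
have [x <-] := pt_surj H y => Ul Ur; rewrite !germ_mcomp.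
have Ux : U (h0 x) by move: Ur; rewrite /= retract_red.
have [V [f0 [f1 [hV [Vx E0 E1]]]]] := local_witt_lift H' w Ux.
have Vhx : V (h (i x)) by rewrite hx.
have k : V `<=` opens_preim (base_cont (theta_morphism pp H')) U.
  move=> z; have [x' <-] := pt_surj H' z => Vx'; rewrite /= retract_red; exact: (hV x' Vx').
have := proj2 (theta_morphismP pp H') U w V k hV f0 f1 E0 E1 => E.
pose hU := opens_preim (base_cont h) (opens_preim (base_cont (theta_morphism pp H')) U).
rewrite -(@germ_res Xt (i x) hU (opens_preim (base_cont h) V) Ul Vhx
  (opens_preim_sub (base_cont h) k)).
rewrite -comap_res E.
rewrite (germ_theta H _ (Ux : opens_preim (base_cont h0) U x) Ur (theta_morphismP pp H)).
have lift (f : sec Xt' V) (s : sec X' U) : comap i' V f = res hV s ->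
   stalk_map i x (@germ Xt (i x) (opens_preim (base_cont h) V) Vhx (comap h V f)) =
   @germ X x (opens_preim (base_cont h0) U) Ux (comap h0 U s).
  move=> fs; rewrite stalk_map_germ -(germ_mcomp (g := h) (f := i) f Vhx).
  rewrite (morphism_germ (f := mcomp h i) (g := mcomp i' h0) f Vhx Vx hE).
  by rewrite germ_mcomp fs comap_res germ_res.
pose hw := witt_germ pp (Ux : opens_preim (base_cont h0) U x) (comap (W2_map pp h0) U w).
rewrite (@stalk_thetaE p pp X Xt i H x hw _ _ (lift _ _ E0) (lift _ _ E1)).
by rewrite !(rmorphD, rmorphMn, rmorphXn).
Qed.
End ThetaNatural.

Section Frob.
Variables (p : nat) (k : fieldType) (pk : p \in [pchar k]).

Lemma germ_frobenius (X : schemeOver k) (V : opens X) (s : sec X V) x (Vx : V x) h :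
  @germ X x (opens_preim (base_cont (frobenius pk X)) V) h (comap (frobenius pk X) V s) =
  germ Vx s ^+ p.
Proof. by rewrite /= (germ_res Vx) rmorphXn. Qed.

Lemma frobenius_natural (X Y : schemeOver k) (f : morphism X Y) :
  mcomp (frobenius pk Y) f = mcomp f (frobenius pk X).
Proof.
apply: morphism_eq => // V s x Vx Vx'; rewrite !germ_mcomp.
rewrite -(stalk_map_germ f (V := opens_preim _ V) Vx) (germ_frobenius s (Vx : V (f x))).
by rewrite rmorphXn (germ_frobenius _ (Vx : opens_preim (base_cont f) V x)) /= stalk_map_germ.
Qed.
End Frob.

(** * Liftings as thickenings *)

Section Lift.
Variables (p : nat) (pp : prime p) (k : fieldType) (pk : p \in [pchar k]).
Variables (X : schemeOver k) (Xt : lifting pp X).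

(** p^2 = 0 already holds in W_2(k). *)
Lemma lifting_p2 y (a : stalk (y : Xt)) : a *+ p *+ p = 0.
Proof.
suff E : p%:R * p%:R = 0 :> stalk y by rewrite -mulrnA -mulr_natr natrM E mulr0.
pose T := opensT (Spec (witt2 pp k)).
have Ty : opens_preim (base_cont (str Xt)) T y by [].
pose c : {rmorphism witt2 pp k -> stalk y} :=
  germ Ty \o (comap (str Xt) T \o (@spec_const (witt2 pp k) T : {rmorphism _ -> sec (Spec _) T})).
rewrite -(rmorph_nat c) -rmorphM (witt_p pp (pcharf0 pk)).
rewrite (_ : _ * _ = 0) ?rmorph0 //.
rewrite -(witt_p pp (pcharf0 pk)) mulr_natr (witt_mulrp (pcharf0 pk)).
by rewrite (witt_p pp (pcharf0 pk)) /= expr0n gtn_eqF ?prime_gt0.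
Qed.

Lemma lifting_thickening : p_thickening p (red Xt).
Proof.
have [j jK Kj] := red_bij Xt.
split; [exact: can_inj jK|by move=> y; exists (j y)|exact: red_open|move=> x].
by split; [exact: red_surj|exact: red_ker|exact: lifting_p2].
Qed.

(** Flatness, with the reduction O_Xt -> O_X in the role of g. *)
Lemma lifting_ann (perf : perfect p k) x (a : stalk (red Xt x)) :
  a *+ p = 0 -> stalk_map (red Xt) x a = 0.
Proof.
have p0 : p%:R = 0 :> stalk x := mod_p_char (pt_stalk lifting_thickening x) 1.
move=> ap.
have annR := @stalk_spec_p p pp k pk perf (str Xt (red Xt x)).
exact: (flat_p annR (stalk_map (red Xt) x) p0 (@total_flat _ _ _ _ Xt (red Xt x)) ap).
Qed.
End Lift.

(** * The morphism psi *)

Section Main.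
Variables (p : nat) (pp : prime p) (k : fieldType) (pk : p \in [pchar k]).
Variables (perf : perfect p k).
Variables (Y : schemeOver k) (Yt : lifting pp Y) (FYt : morphism Yt Yt).
Hypothesis FYt_lifts : lifts Yt Yt (frobenius pk Y) FYt.

Lemma frob_lift_base x : FYt (red Yt x) = red Yt x.
Proof. by move: (congr1 (fun f : morphism Y Yt => f x) FYt_lifts). Qed.

Lemma frob_lift_stalk (V : opens Yt) (f : sec Yt V) x (h : V (red Yt x))
  (h' : opens_preim (base_cont FYt) V (red Yt x)) :
  stalk_map (red Yt) x (germ h' (comap FYt V f)) = stalk_map (red Yt) x (germ h f) ^+ p.
Proof.
rewrite !stalk_map_germ -(germ_mcomp (g := FYt) (f := red Yt) f h').
rewrite (morphism_germ (f := mcomp FYt (red Yt)) (g := mcomp (red Yt) (frobenius pk Y)) f h' h) //.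
by rewrite germ_mcomp (germ_frobenius _ (h : opens_preim (base_cont (red Yt)) V x)).
Qed.

Definition lifting_nu : morphism (W2 pp Y) Yt :=
  nu_morphism pp (lifting_thickening pk Yt)
    (@lifting_ann _ _ _ pk _ Yt perf) frob_lift_base frob_lift_stalk.

Variables (Z : schemeOver k) (Zt : lifting pp Z) (phi : morphism Z Y).

Definition psi : morphism Zt Yt :=
  mcomp lifting_nu (mcomp (W2_map pp phi) (theta_morphism pp (lifting_thickening pk Zt))).

(** At a point of Z, psi^*(f) = theta(W_2(phi)^*(nu^*(f))) reduces to the p-th power
    of the first component phi^*(f mod p). *)
Lemma psi_red : mcomp psi (red Zt) = mcomp (red Yt) (mcomp (frobenius pk Y) phi).
Proof.
apply: morphism_eq => [x|V f x Vx Vx']; first by rewrite /= retract_red.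
rewrite germ_mcomp -(stalk_map_germ (red Zt) (V := opens_preim (base_cont psi) V) Vx).
rewrite !germ_mcomp /=.
have Ux : opens_preim (base_cont phi) (opens_preim (base_cont (red Yt)) V) x by [].
rewrite (germ_theta (lifting_thickening pk Zt) _ Ux Vx (theta_morphismP _ _)).
rewrite theta_fun_red /=; have [-> _] := nu_secP pp (lifting_thickening pk Yt)
  (@lifting_ann _ _ _ pk _ Yt perf) frob_lift_base frob_lift_stalk f.
rewrite comap_res (germ_res Ux).
by rewrite /frob_fun !rmorphXn.
Qed.

End Main.

Theorem proposition5p1 (p : nat) (pp : prime p) (k : fieldType)
  (pk : p \in [pchar k]) (k_perfect : perfect p k)
  (Y : schemeOver k) (Yt : lifting pp Y) (FYt : morphism Yt Yt)
  (FYt_lifts : lifts Yt Yt (frobenius pk Y) FYt)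
  (Z : schemeOver k) (phi : morphism Z Y) (phi_over : over_morphism phi)
  (Zt : lifting pp Z) :
  exists (theta : morphism Zt (W2 pp Z)) (nu : morphism (W2 pp Y) Yt)
         (psi : morphism Zt Yt),
    unique (is_theta pp (red Zt)) theta /\
    unique (is_nu pp (red Yt) FYt) nu /\
    psi = mcomp nu (mcomp (W2_map pp phi) theta) /\
    mcomp psi (red Zt) = mcomp (red Yt) (mcomp (frobenius pk Y) phi) /\
    (forall FZt : morphism Zt Zt,
        lifts Zt Zt (frobenius pk Z) FZt ->
        mcomp psi FZt = mcomp FYt psi) /\
    (forall phit : morphism Zt Yt,
        lifts Zt Yt phi phit -> psi = mcomp FYt phit).
Proof.
pose HZ := lifting_thickening pk Zt; pose HY := lifting_thickening pk Yt.
pose th := theta_morphism pp HZ; pose nu := lifting_nu k_perfect FYt_lifts.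
exists th, nu, (mcomp nu (mcomp (W2_map pp phi) th)).
have nuth : mcomp nu (theta_morphism pp HY) = FYt by exact: nu_theta.
have red_psi := psi_red k_perfect FYt_lifts Zt phi.
split; first by split; [exact: theta_morphismP|exact: theta_unique].
split; first by split; [exact: nu_morphismP|exact: nu_unique].
split=> //; split=> //.
split=> [FZt FZtE|phit phitE].
  (* psi itself lifts Frob_Y o phi: this is what turns F_Y o psi into nu o W_2. *)
  rewrite -{1}nuth -!mcompA (theta_natural pp HZ HZ FZtE) (theta_natural pp HZ HY red_psi).
  by rewrite (frobenius_natural pk phi) W2_map_comp !mcompA.
by rewrite -nuth -mcompA (theta_natural pp HZ HY phitE) mcompA.
Qed.
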